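(* Let $G$ be a finite group, let $b$ be a block of principal type of $kG$ and let $P$ be a defect group of $b$. Let $S$ be a simple $kGb$-module and let $R$ be a vertex of $S$. If $Q$ is a subgroup with $R \leq Q < P$ (the second inclusion being proper), then $m_b^1(Q)=0$.
   Context: $k$ is an algebraically closed field of characteristic $p>0$, the residue field of a complete discrete valuation ring $\mathcal{O}$ of characteristic $0$. Modules are finitely generated right modules. A block of $kG$ is a primitive idempotent of the center $ZkG$ of $kG$. Principal type: for a $p$-subgroup $Q$ of $G$, the Brauer homomorphism $\mathrm{Br}_Q$ on $ZkG$ sends $\sum_{g\in G}a_g g$ to $\sum_{g\in C_G(Q)}a_g g$. The block $b$ is of principal type if $\mathrm{Br}_Q(b)$ is a block of $kC_G(Q)$ for every $p$-subgroup $Q$ contained in a defect group of $b$. Multiplicity $m_b^1(Q)$: let $G_{p'}$ be the set of $p$-regular elements of $G$ (elements of order prime to $p$), $kG_{p'}$ the $k$-span of $G_{p'}$ in $kG$, $\mathrm{Cl}(G_{p'})$ the set of $p$-regular conjugacy classes, $ZkG_{p'}=ZkG\cap kG_{p'}$, and $\hat C=\sum_{x\in C}x$ for a class $C$. There is a disjoint decomposition $\mathrm{Cl}(G_{p'})=\bigcup_b \mathrm{Cl}_{p'}(b)$, with $b$ ranging over the blocks of $kG$, such that $\{\hat C b \mid C\in \mathrm{Cl}_{p'}(b)\}$ is a basis of $ZkG_{p'}b$ for every block $b$. Write $\mathrm{Cl}_{p'}(b)=\{C_i\}_{1\le i\le l(b)}$ and let $Q_i$ be a defect group of $C_i$, i.e.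 a Sylow $p$-subgroup of $C_G(x_i)$ for some $x_i\in C_i$. For a $p$-subgroup $Q$ of $G$, $m_b^1(Q)$ is the number of $i$ with $1\le i\le l(b)$ such that $Q_i$ is $G$-conjugate to $Q$. (It is known that this number does not depend on the choice of decomposition.) *)

(* Defs.v *)
From mathcomp Require Import all_boot all_order all_algebra.
From mathcomp Require Import all_fingroup all_solvable.
From mathcomp Require Export mxrepresentation.

Set Implicit Arguments.
Unset Strict Implicit.
Unset Printing Implicit Defensive.

Import GRing.Theory.
Local Open Scope group_scope.
Local Open Scope ring_scope.

(* An element of kG is a matrix A with (A \in group_ring k G)%MS, i.e. the    *)
(* matrix of right multiplication by that element on the regular module; the  *)
(* group element x is regular_repr k G x, the product of kG is *m, and the    *)
(* right kG-modules are spaces of row vectors.                                *)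

Section GroupAlgebra.

Variables (k : fieldType) (gT : finGroupType).
Implicit Types (G H D Q : {group gT}).

Definition gring_coef G (a : 'M[k]_#|G|) (x : gT) : k :=
  gring_row a 0 (gring_index G x).

Definition is_central_idempotent G (e : 'M[k]_#|G|) : Prop :=
  (e \in 'Z(group_ring k G))%MS /\ e *m e = e.

Definition is_block G (b : 'M[k]_#|G|) : Prop :=
  [/\ is_central_idempotent b, b <> 0 &
      forall e f : 'M[k]_#|G|,
        is_central_idempotent e -> is_central_idempotent f ->
        e *m f = 0 -> e + f = b -> e = 0 \/ f = 0].

Definition gring_conj G (a : 'M[k]_#|G|) (x : gT) : 'M[k]_#|G| :=
  regular_repr k G x^-1%g *m a *m regular_repr k G x.

Definition gring_fixed G H (a : 'M[k]_#|G|) : Prop :=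
  (a \in group_ring k G)%MS /\ forall x, x \in H -> gring_conj a x = a.

(* Tr_H^G; the value at an H-fixed element does not depend on the chosen      *)
(* representatives of the right cosets H x.                                   *)
Definition rel_trace G H (a : 'M[k]_#|G|) : 'M[k]_#|G| :=
  \sum_(X in rcosets H G) gring_conj a (repr X).

Definition in_rel_trace G H (b : 'M[k]_#|G|) : Prop :=
  exists2 a, gring_fixed H a & b = rel_trace H a.

Definition is_block_defect_group G (b : 'M[k]_#|G|) D : Prop :=
  [/\ D \subset G, in_rel_trace D b &
      forall H, H \subset D -> in_rel_trace H b -> H :=: D].

Definition Brauer_map G Q (a : 'M[k]_#|G|) : 'M[k]_#|'C_G(Q)| :=
  \sum_(x in 'C_G(Q)) gring_coef a x *: regular_repr k 'C_G(Q)%G x.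

Definition principal_type (p : nat) G (b : 'M[k]_#|G|) : Prop :=
  forall D Q, is_block_defect_group b D -> Q \subset D -> p.-group Q ->
    is_block (Brauer_map Q b).

Definition repr_hom G (A : {set gT}) m n (rM : mx_representation k G m)
    (rN : mx_representation k G n) (f : 'M[k]_(m, n)) : Prop :=
  forall x, x \in A -> rM x *m f = f *m rN x.

(* Every short exact sequence of kG-modules ending in the given module splits *)
(* as soon as it splits over kH.                                              *)
Definition rel_projective G H n (rM : mx_representation k G n) : Prop :=
  forall (m : nat) (rN : mx_representation k G m) (f : 'M[k]_(m, n)),
    repr_hom G rN rM f ->
    (exists2 s, repr_hom H rM rN s & s *m f = 1%:M) ->
    exists2 s, repr_hom G rM rN s & s *m f = 1%:M.

Definition is_vertex G n (rM : mx_representation k G n) (R : {group gT}) :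
    Prop :=
  [/\ R \subset G, rel_projective R rM &
      forall H, H \subset R -> rel_projective H rM -> H :=: R].

(* As a right kG-module, rS is a kGb-module iff b acts on it as the identity. *)
Definition is_simple_block_module G (b : 'M[k]_#|G|) n
    (rS : mx_representation k G n) : Prop :=
  mx_irreducible rS /\ gring_op rS b = 1%:M.

Definition preg_classes (p : nat) G : {set {set gT}} :=
  [set C in classes G | [forall x in C, p^'.-elt x]].

(* The row spaces of the next two matrices encode, through mxvec, the spaces  *)
(* ZkG_{p'} = ZkG :&: kG_{p'} and ZkG_{p'} b.                                 *)
Definition preg_center (p : nat) G : 'M[k]_(#|G| * #|G|) :=
  ('Z(group_ring k G) :&:
     \sum_(x in G | p^'.-elt x) <<mxvec (regular_repr k G x)>>)%MS.

Definition preg_center_block (p : nat) G (b : 'M[k]_#|G|) :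
    'M[k]_(#|G| * #|G|) :=
  preg_center p G *m lin_mulmxr b.

Definition class_family G (b : 'M[k]_#|G|) (X : {set {set gT}}) :
    'M[k]_(#|X|, #|G| * #|G|) :=
  \matrix_(i < #|X|) mxvec (gset_mx k G (enum_val i) *m b).

(* clp b is Cl_{p'}(b); its values outside of the blocks are irrelevant.      *)
Definition is_block_class_decomposition (p : nat) G
    (clp : 'M[k]_#|G| -> {set {set gT}}) : Prop :=
  [/\ forall b, is_block b -> clp b \subset preg_classes p G,
      forall C, C \in preg_classes p G -> exists2 b, is_block b & C \in clp b,
      forall b b', is_block b -> is_block b' -> b <> b' ->
        [disjoint clp b & clp b'] &
      forall b, is_block b ->
        row_free (class_family b (clp b)) /\
        (class_family b (clp b) == preg_center_block p b)%MS].

End GroupAlgebra.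

Definition class_defect_group (gT : finGroupType) (p : nat) (G : {group gT})
    (C : {set gT}) (D : {group gT}) : bool :=
  [exists x in C, p.-Sylow('C_G[x]) D].

(* m_b^1(Q), computed from Cl_{p'}(b) = X. The defect groups of a class form  *)
(* one G-conjugacy class, so it does not matter which of them is used.        *)
Definition lower_defect_mult (gT : finGroupType) (p : nat) (G : {group gT})
    (X : {set {set gT}}) (Q : {group gT}) : nat :=
  #|[set C in X | [exists D : {group gT},
       class_defect_group p G C D && (gval D \in gval Q :^: G)]]|.

(* Main.v *)
Require Import Defs.
From mathcomp Require Import all_boot all_order all_algebra.
From mathcomp Require Import all_fingroup all_solvable.

(* Let C be a p-regular class of defect group Q, in the family of b, and c its
   class sum. By Osima's theorem the elements c b are p-regularly supported, and
   their supports involve only classes of defect at most |Q|.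

   Following Knoerr, Br_R(b) has defect group Z(R): modulo the largest ideal
   contained in the kernel of the trace from R to G, the R-endomorphisms of S
   have a section on which C_G(R) / Z(R) acts with a projective constituent in
   the block Br_R(b). Hence p-subgroups of C_G(R) centralizing an element of the
   support of b lie in R, and for R <= Q the block Br_Q(b) of C_G(Q) has its
   defect groups in Z(Q). A p-regularly supported central element then acts on
   Br_Q(b) as a scalar, so Br_Q(c b) = w Br_Q(b). If Q < P, then c b vanishes on
   C_G(P), because P centralizes no element of C, while Br_P(b) <> 0; so w = 0.
   Thus c b is a combination of class sums of defect smaller than |Q|. But the
   p-regular classes of defect smaller than |Q|, multiplied by their blocks, are
   independent and span a space of at most their number, leaving no room
   for c b. *)

(** Two properties of the vertex drive the argument: the identity of S is a trace to G of an
    R-endomorphism, and traces to G from proper subgroups of R vanish. Modulo the vertex ideal, a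
    sum over an R-set therefore reduces to its fixed points. Hence b acts through Br_R(b), and a
    trace from R to G becomes a sum over N_G(R). The obstacle is that Z(R) acts on the quotient by
    commuting unipotent operators, not trivially; passing to its fixed points gives a module for
    C_G(R) / Z(R). That module is projective, but simple submodules do not inherit this in general.
    Here N_G(R) forces it, because N_G(R)-stable sums over C_G(R) act as scalars. One projective
    simple module suffices because the centre of a block is local: a central trace from Z(R) that is
    not nilpotent on Br_R(b) is invertible there. The same locality yields the scalar w up to a
    nilpotent part, which p-regularity then removes. *)

Module BlocksOfPrincipalType.

Set Implicit Arguments.
Unset Strict Implicit.
Unset Printing Implicit Defensive.
Import GRing.Theory.
Local Open Scope group_scope.
Local Open Scope ring_scope.

(** * Sums over coset representatives and over fixed points of p-groups *)

Section CosetSums.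

Local Open Scope group_scope.

Variables (gT : finGroupType) (V : nmodType).
Implicit Types (G H K : {group gT}) (f : gT -> V).

(** Shaped like [rel_trace], so that traces on the group algebra, on endomorphisms and on
    representations share the lemmas below. Under [left_invariant] the choice of representatives is
    immaterial. *)
Definition coset_sum H G f : V := \sum_(X in rcosets H G) f (repr X).

Definition left_invariant H G f :=
  forall h x, h \in H -> x \in G -> f (h * x)%g = f x.

Lemma repr_rcosets_mem H G X : X \in rcosets H G -> H \subset G -> repr X \in G.
Proof.
case/rcosetsP=> x Gx -> sHG.
by case: repr_rcosetP => h Hh; rewrite groupM // (subsetP sHG).
Qed.

Lemma left_invariant_repr H G f x :
  left_invariant H G f -> x \in G -> f (repr (H :* x)) = f x.
Proof.
by move=> fH Gx; have /rcosetP[h Hh ->] := mem_repr_rcoset H x; rewrite fH.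
Qed.

Lemma eq_coset_sum H G f1 f2 :
  H \subset G -> {in G, f1 =1 f2} -> coset_sum H G f1 = coset_sum H G f2.
Proof.
by move=> sHG eqf; apply: eq_bigr => X HX; rewrite eqf ?(repr_rcosets_mem HX).
Qed.

Lemma coset_sumMr H G f g :
  H \subset G -> left_invariant H G f -> g \in G ->
  coset_sum H G (fun x => f (x * g)%g) = coset_sum H G f.
Proof.
move=> sHG fH Gg; rewrite /coset_sum.
rewrite [RHS](reindex_onto (fun X : {set gT} => X :* g) (fun X => X :* g^-1)) /=.
  apply: eq_big => X; last first.
    case/rcosetsP=> x Gx ->; rewrite -rcosetM.
    rewrite (left_invariant_repr fH) ?groupM //.
    by case: repr_rcosetP => h Hh; rewrite -mulgA fH ?groupM.
  rewrite -rcosetM mulgV rcoset1 eqxx andbT; apply/idP/idP.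
    by case/rcosetsP=> x Gx ->; rewrite -rcosetM -rcosetE imset_f ?groupM.
  case/rcosetsP=> x Gx /(congr1 (fun Y => Y :* g^-1)).
  rewrite -!rcosetM mulgV rcoset1 => ->.
  by rewrite -rcosetE imset_f ?groupM ?groupV.
by move=> X _; rewrite -rcosetM mulVg rcoset1.
Qed.

Lemma coset_sumJ H G f g :
    H \subset G -> left_invariant H G f -> g \in 'N(H) -> g \in 'N(G) ->
  coset_sum H G (fun x => f (x ^ g)) = coset_sum H G f.
Proof.
move=> sHG fH nHg nGg; rewrite /coset_sum.
have gH y x : y \in 'N(H) -> (H :* x) :^ y = H :* x ^ y.
  by move=> nHy; rewrite conjsMg conjg_set1 (normP nHy).
have memJ y X : y \in 'N(H) -> y \in 'N(G) -> X \in rcosets H G -> X :^ y \in rcosets H G.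
  move=> nHy nGy /rcosetsP[x Gx ->]; rewrite gH // -rcosetE imset_f //.
  by rewrite memJ_norm.
have fgH : left_invariant H G (fun x => f (x ^ g)).
  by move=> h x Hh Gx; rewrite conjMg [LHS]fH ?memJ_norm.
rewrite [RHS](reindex_onto (fun X => X :^ g) (fun X => X :^ g^-1)) /=.
  apply: eq_big => X.
    rewrite -conjsgM mulgV conjsg1 eqxx andbT; apply/idP/idP; first exact: memJ.
    by move/(memJ g^-1); rewrite !groupV -conjsgM mulgV conjsg1; apply.
  case/rcosetsP=> x Gx ->; rewrite gH // (left_invariant_repr fH) ?memJ_norm //.
  exact: (left_invariant_repr fgH).
by move=> X _; rewrite -conjsgM mulVg conjsg1.
Qed.

Lemma coset_sum_trans H K G f :
  H \subset K -> K \subset G -> left_invariant H G f ->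
  coset_sum H G f =
  coset_sum K G (fun y => coset_sum H K (fun x => f (x * y)%g)).
Proof.
move=> sHK sKG fH; rewrite /coset_sum.
rewrite (partition_big (fun X => K :* repr X) (mem (rcosets K G))) /=; last first.
  move=> X HX; rewrite -rcosetE imset_f //.
  exact: (repr_rcosets_mem HX (subset_trans sHK sKG)).
apply: eq_bigr => Y KY; set y := repr Y.
have Gy : y \in G by exact: (repr_rcosets_mem KY).
have defY : Y = K :* y by rewrite /y; case/rcosetsP: KY => x Gx ->; rewrite rcoset_repr.
rewrite (reindex_onto (fun X : {set gT} => X :* y) (fun X => X :* y^-1)) /=.
  apply: eq_big => X; last first.
    case/andP=> /andP[HXy _] /eqP.
    have [x Gx ->] := rcosetsP HXy.
    rewrite -rcosetM (left_invariant_repr fH) // => <-.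
    case: repr_rcosetP => h Hh.
    by rewrite -!mulgA mulVg mulg1 fH.
  rewrite -rcosetM mulgV rcoset1 eqxx andbT; apply/andP/idP.
    case=> /rcosetsP[x Gx defX] /eqP; rewrite defX defY => eqY.
    have Hr := mem_repr_rcoset H x; set r := repr _ in Hr eqY.
    have: r \in K :* y by rewrite -eqY rcoset_refl.
    case/rcosetP: Hr => h Hh -> Khxy.
    move/(congr1 (fun Y => Y :* y^-1)): defX; rewrite -!rcosetM mulgV rcoset1 => ->.
    rewrite -rcosetE imset_f // -(groupMl _ (subsetP sHK h Hh)) mulgA.
    by rewrite mem_rcoset in Khxy.
  case/rcosetsP=> x Kx ->; rewrite -rcosetM; split.
    by rewrite -rcosetE imset_f // groupM // (subsetP sKG).
  apply/eqP; rewrite defY; apply/esym/rcoset_eqP.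
  case: repr_rcosetP => h Hh.
  rewrite mem_rcoset invMg mulgA invMg mulgA mulgV mul1g.
  by rewrite groupM ?groupV // (subsetP sHK).
by move=> X _; rewrite -rcosetM mulVg rcoset1.
Qed.

End CosetSums.

(** An orbit that is not a fixed point has length a positive power of p, and F, constant on it, sums
    there to 0. This is behind the multiplicativity of the Brauer map, the rotation of words and the
    support of relative traces. *)
Lemma pgroup_sum_fix (k : fieldType) (p : nat) (aT : finGroupType)
    (D : {group aT}) (sT : finType) (to : action D sT) (P : {group aT})
    (S : {set sT}) (F : sT -> k) :
    p \in [pchar k] -> p.-group P -> [acts P, on S | to] ->
    (forall x a, x \in S -> a \in P -> F (to x a) = F x) ->
  \sum_(x in S) F x = \sum_(x in 'Fix_(S | to)(P)) F x.
Proof.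
move=> charkp pP nSP FP; have sPD := acts_dom nSP.
rewrite (big_setID 'Fix_to(P)) -[RHS]addr0; congr (_ + _).
have nS'P: [acts P, on S :\: 'Fix_to(P) | to].
  rewrite actsD // -(setIidPr sPD); apply: subset_trans (acts_subnorm_fix _ _).
  by rewrite setIS ?normG.
rewrite (partition_big_imset (orbit to P)) /= big1 // => O /imsetP[x Sx ->{O}].
have [k0 oPx]: {k0 | #|orbit to P x| = (p ^ k0)%N}.
  by apply: p_natP; apply: pnat_dvd pP; rewrite card_orbit_in ?dvdn_indexg.
transitivity (\sum_(y in orbit to P x) F x).
  apply: eq_big => [y | y /andP[_ /eqP eqO]].
    apply/andP/idP=> [[_ /eqP <-] | xPy]; first exact: orbit_refl.
    have Sy: y \in S :\: 'Fix_to(P).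
      by have := acts_sub_orbit x nS'P; rewrite Sx => /subsetP->.
    by split=> //; apply/eqP/orbit_in_eqP.
  have /orbitP[a Pa <-]: y \in orbit to P x by rewrite -eqO orbit_refl.
  by rewrite FP //; case/setDP: Sx.
rewrite sumr_const oPx; case: k0 oPx => [/card_orbit1 fix_x | k0 _].
  case/setDP: Sx => _ /afixP[] a Pa.
  by apply/set1P; rewrite -fix_x mem_orbit.
by rewrite expnS mulrnA -(mulr_natr (F x)) (pcharf0 charkp) mulr0 mul0rn.
Qed.

(** * The Brauer homomorphism *)

Section GroupRingCoefficients.

Variables (k : fieldType) (gT : finGroupType) (G : {group gT}).
Local Notation R_G := (group_ring k G).
Local Notation aG := (regular_repr k G).
Implicit Types A B : 'M[k]_#|G|.

Lemma gring_coefE A x : gring_coef A x = A (gring_index G 1) (gring_index G x).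
Proof. by rewrite /gring_coef mxE. Qed.

Lemma gring_coefB A B x : gring_coef (A - B) x = gring_coef A x - gring_coef B x.
Proof. by rewrite !gring_coefE !mxE. Qed.

Lemma gring_coefZ c A x : gring_coef (c *: A) x = c * gring_coef A x.
Proof. by rewrite !gring_coefE mxE. Qed.

Lemma gring_coef_sum (I : Type) (r : seq I) (P : pred I) (F : I -> 'M[k]_#|G|) x :
  gring_coef (\sum_(i <- r | P i) F i) x = \sum_(i <- r | P i) gring_coef (F i) x.
Proof.
by rewrite gring_coefE summxE; apply: eq_bigr => i _; rewrite gring_coefE.
Qed.

Lemma gring_coef_repr : {in G &, forall x y, gring_coef (aG x) y = (x == y)%:R}.
Proof.
move=> x y Gx Gy; rewrite eq_sym.
transitivity (@gring_proj k gT G y (aG x) 0 0); last first.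
  by rewrite gring_projE //; case: eqP; rewrite ?mulr1n mxE.
by rewrite gring_coefE !mxE.
Qed.

Lemma gring_coef_comb (c : gT -> k) :
  {in G, gring_coef (\sum_(x in G) c x *: aG x) =1 c}.
Proof.
move=> y Gy; rewrite gring_coef_sum (bigD1 y) //= big1 => [|x /andP[Gx ne]].
  by rewrite addr0 gring_coefZ gring_coef_repr // eqxx mulr1.
by rewrite gring_coefZ gring_coef_repr // (negPf ne) mulr0.
Qed.

Lemma gring_comb_mem (c : gT -> k) : (\sum_(x in G) c x *: aG x \in R_G)%MS.
Proof. by apply/envelop_mxP; exists c. Qed.

Lemma gring_coefK A :
  (A \in R_G)%MS -> A = \sum_(x in G) gring_coef A x *: aG x.
Proof.
by case/envelop_mxP=> c ->; apply: eq_bigr => x Gx; rewrite gring_coef_comb.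
Qed.

Lemma gring_coef_inj A B :
  (A \in R_G)%MS -> (B \in R_G)%MS -> {in G, gring_coef A =1 gring_coef B} ->
  A = B.
Proof.
move=> RA RB eqAB; rewrite (gring_coefK RA) (gring_coefK RB).
by apply: eq_bigr => x Gx; rewrite eqAB.
Qed.

Lemma gring_coefM A B g :
  (A \in R_G)%MS -> (B \in R_G)%MS -> g \in G ->
  gring_coef (A *m B) g =
  \sum_(x in G) gring_coef A x * gring_coef B (x^-1 * g)%g.
Proof.
move=> RA RB Gg; rewrite {1}(gring_coefK RA) mulmx_suml gring_coef_sum.
apply: eq_bigr => x Gx; rewrite -scalemxAl gring_coefZ; congr (_ * _).
rewrite {1}(gring_coefK RB) mulmx_sumr gring_coef_sum.
have Gxg : (x^-1 * g)%g \in G by rewrite groupM ?groupV.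
rewrite (bigD1 (x^-1 * g)%g) //= big1 => [|y /andP[Gy ne]].
  by rewrite addr0 -scalemxAr -repr_mxM // mulKVg gring_coefZ gring_coef_repr // eqxx mulr1.
rewrite -scalemxAr -repr_mxM // gring_coefZ gring_coef_repr ?groupM //.
by rewrite (can2_eq (mulKg x) (mulKVg x)) (negPf ne) mulr0.
Qed.

Lemma gring_coefMr A B g :
  (A \in R_G)%MS -> (B \in R_G)%MS -> g \in G ->
  gring_coef (A *m B) g =
  \sum_(x in G) gring_coef A (g * x^-1)%g * gring_coef B x.
Proof.
move=> RA RB Gg; rewrite gring_coefM //.
rewrite (reindex_onto (fun x => g * x^-1)%g (fun x => x^-1 * g)%g) /=.
  apply: eq_big => [x|x _]; last by rewrite invMg invgK mulgKV.
  rewrite invMg invgK mulgKV eqxx andbT groupMl //.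
  by rewrite groupV.
by move=> x _; rewrite invMg invgK mulKVg.
Qed.

Lemma gring_op_coef n (rG : mx_representation k G n) A :
  (A \in R_G)%MS -> gring_op rG A = \sum_(x in G) gring_coef A x *: rG x.
Proof.
move=> RA; rewrite {1}(gring_coefK RA) linear_sum.
by apply: eq_bigr => x Gx; rewrite linearZ /= gring_opG.
Qed.

Lemma gring_center_coefP A :
  (A \in 'Z(R_G))%MS <->
  (A \in R_G)%MS /\ {in G &, forall x y, gring_coef A (x ^ y)%g = gring_coef A x}.
Proof.
split.
  rewrite sub_capmx memmx_cent_envelop => /andP[RA /centgmxP cA]; split=> // x y Gx Gy.
  have Gxy: (x ^ y)%g \in G by rewrite groupJ.
  have RaG z : z \in G -> (aG z \in R_G)%MS by exact: envelop_mx_id.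
  have Gyxy: (y * x ^ y)%g \in G by exact: groupM.
  (* The element y x^y equals x y; its coefficients in y A and in A y are those of A at x^y and at
     x. *)
  transitivity (gring_coef (aG y *m A) (y * x ^ y)%g).
    rewrite gring_coefM ?RaG // (bigD1 y) //= big1 => [|z /andP[Gz ne]].
      by rewrite gring_coef_repr // eqxx mul1r addr0 mulKg.
    by rewrite gring_coef_repr // eq_sym (negPf ne) mul0r.
  rewrite -cA // gring_coefMr ?RaG // (bigD1 y) //= big1 => [|z /andP[Gz ne]].
    by rewrite gring_coef_repr // eqxx mulr1 addr0 -conjgC mulgK.
  by rewrite gring_coef_repr // eq_sym (negPf ne) mulr0.
case=> RA clA; rewrite sub_capmx RA memmx_cent_envelop; apply/centgmxP=> y Gy.
rewrite (gring_coefK RA) mulmx_suml mulmx_sumr.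
rewrite [RHS](reindex_acts 'J _ Gy) ?astabsJ ?normG //=.
apply: eq_bigr => x Gx; rewrite -scalemxAl -scalemxAr clA // -!repr_mxM ?groupJ //.
by rewrite -conjgC.
Qed.

Lemma gring_centerC A B :
  (A \in 'Z(R_G))%MS -> (B \in R_G)%MS -> A *m B = B *m A.
Proof.
rewrite sub_capmx => /andP[_ /cent_mxP cA] RB; exact/esym/cA.
Qed.

Lemma gring_center_mem A : (A \in 'Z(R_G))%MS -> (A \in R_G)%MS.
Proof. by rewrite sub_capmx => /andP[]. Qed.

Lemma gring_centerM A B :
  (A \in 'Z(R_G))%MS -> (B \in 'Z(R_G))%MS -> (A *m B \in 'Z(R_G))%MS.
Proof.
move=> ZA ZB; have RA := gring_center_mem ZA; have RB := gring_center_mem ZB.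
rewrite sub_capmx envelop_mxM //=; apply/cent_mxP => C RC.
by rewrite mulmxA -(gring_centerC ZA) // -!mulmxA (gring_centerC ZB).
Qed.

End GroupRingCoefficients.

Section BrauerMap.

Variables (k : fieldType) (p : nat) (charkp : p \in [pchar k]).
Variables (gT : finGroupType) (G : {group gT}).
Implicit Types (A B : 'M[k]_#|G|) (Q : {group gT}).

Lemma Brauer_map_coef Q A : {in 'C_G(Q), gring_coef (Brauer_map Q A) =1 gring_coef A}.
Proof. by move=> x Cx; rewrite /Brauer_map (gring_coef_comb (G := 'C_G(Q)%G)). Qed.

Lemma Brauer_map_mem Q A : (Brauer_map Q A \in group_ring k 'C_G(Q)%G)%MS.
Proof. exact: (gring_comb_mem 'C_G(Q)%G). Qed.

Lemma Brauer_map_center Q A :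
  (A \in 'Z(group_ring k G))%MS ->
  (Brauer_map Q A \in 'Z(group_ring k 'C_G(Q)%G))%MS.
Proof.
case/gring_center_coefP=> RA clA; apply/gring_center_coefP.
split=> [|x y Cx Cy]; first exact: Brauer_map_mem.
rewrite !Brauer_map_coef ?(groupJ (G := 'C_G(Q)%G)) //.
by case/setIP: Cx => Gx _; case/setIP: Cy => Gy _; apply: clA.
Qed.

(** Q permutes by conjugation the factorizations of g, which it centralizes; modulo p only those
    fixed by Q count. *)
Lemma gring_coefM_fix Q A B g :
    p.-group Q -> Q \subset G -> g \in 'C_G(Q) ->
    (A \in 'Z(group_ring k G))%MS -> (B \in 'Z(group_ring k G))%MS ->
  gring_coef (A *m B) g =
  \sum_(x in 'C_G(Q)) gring_coef A (g * x^-1)%g * gring_coef B x.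
Proof.
move=> pQ sQG /setIP[Gg cQg] /gring_center_coefP[RA clA] /gring_center_coefP[RB clB].
rewrite gring_coefMr //.
have nGQ: [acts Q, on G | 'J] by rewrite astabsJ (subset_trans sQG) ?normG.
rewrite (pgroup_sum_fix charkp pQ nGQ) => [|x a Gx Qa] /=.
  by apply: eq_bigl => x; rewrite afixJ.
have Ga := subsetP sQG a Qa; rewrite clB //; congr (_ * _).
rewrite -[RHS](clA _ a) ?groupM ?groupV //; congr (gring_coef A _).
rewrite conjMg conjVg; congr (_ * _)%g; apply/esym/conjg_fixP.
by apply/commgP; apply: (centP cQg).
Qed.

Lemma Brauer_mapM Q A B :
    p.-group Q -> Q \subset G ->
    (A \in 'Z(group_ring k G))%MS -> (B \in 'Z(group_ring k G))%MS ->
  Brauer_map Q (A *m B) = Brauer_map Q A *m Brauer_map Q B.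
Proof.
move=> pQ sQG ZA ZB.
apply: gring_coef_inj; rewrite ?envelop_mxM ?Brauer_map_mem // => g Cg.
rewrite Brauer_map_coef // (gring_coefM_fix pQ) // gring_coefMr ?Brauer_map_mem //.
apply: eq_bigr => x Cx; rewrite !Brauer_map_coef //.
by rewrite (groupM (G := 'C_G(Q)%G)) ?groupV.
Qed.

End BrauerMap.

(** * Osima's theorem *)

Section PowerTrace.

Variables (k : fieldType) (p : nat) (charkp : p \in [pchar k]).
Variables (gT : finGroupType) (G : {group gT}).
Local Notation aG := (regular_repr k G).

Lemma gring_comb_exp (c : gT -> k) q :
  (\sum_(x in G) c x *: aG x) ^+ q =
  \sum_(f : {ffun 'I_q -> gT} | f \in ffun_on (mem G))
     (\prod_i c (f i)) *: aG (\prod_i f i)%g.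
Proof.
rewrite -{1}(card_ord q) -prodr_const bigA_distr_big.
apply: eq_bigr => f /ffun_onP Gf.
elim: q f Gf => [|q IHq] f Gf; first by rewrite !big_ord0 scale1r repr_mx1.
rewrite !big_ord_recl.
pose g : {ffun 'I_q -> gT} := [ffun j => f (lift ord0 j)].
have Gg i : g i \in G by rewrite ffunE.
have fg i : f (lift ord0 i) = g i by rewrite ffunE.
rewrite (eq_bigr (fun i => c (g i) *: aG (g i))) => [|i _]; last by rewrite fg.
rewrite [in RHS](eq_bigr (fun i => c (g i))) => [|i _]; last by rewrite fg.
rewrite [in RHS](eq_bigr (fun i => g i)) => [|i _]; last by rewrite fg.
rewrite IHq // -[LHS]/(_ *m _) -scalemxAl -scalemxAr scalerA -repr_mxM //.
exact: group_prod.
Qed.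

(* Brauer's argument: modulo commutators, cyclic rotation of the words in the *)
(* expansion of the q-th power leaves only the constant words.                *)
Lemma class_fun_gring_exp (c F : gT -> k) m (q := (p ^ m)%N) :
    {in G &, forall x y, F (x ^ y)%g = F x} ->
  \sum_(x in G) gring_coef ((\sum_(y in G) c y *: aG y) ^+ q) x * F x =
  \sum_(x in G) c x ^+ q * F (x ^+ q)%g.
Proof.
move=> clF; have p_pr := pcharf_prime charkp.
have: (0 < q)%N by rewrite expn_gt0 prime_gt0.
rewrite gring_comb_exp; have: p.-nat q by rewrite pnatX pnat_id.
(* From here on the word length is [q.+1], of which only being a power of p is remembered. *)
case: q => // q pq _.
transitivity (\sum_(f : {ffun 'I_q.+1 -> gT} | f \in ffun_on (mem G))
    (\prod_i c (f i)) * F (\prod_i f i)%g).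
  under eq_bigr => x _ do rewrite gring_coef_sum mulr_suml.
  rewrite exchange_big /=; apply: eq_bigr => f /ffun_onP Gf.
  have Gp: (\prod_i f i)%g \in G by apply: group_prod.
  rewrite (bigD1 _ Gp) /= [X in _ + X]big1 => [|x /andP[Gx ne]].
    by rewrite addr0 gring_coefZ gring_coef_repr // eqxx mulr1.
  by rewrite gring_coefZ gring_coef_repr // eq_sym (negPf ne) mulr0 mul0r.
pose rot (f : {ffun 'I_q.+1 -> gT}) := [ffun i => f (ordS i)].
have rot_inj : injective rot.
  move=> f g /ffunP efg; apply/ffunP=> i.
  by have := efg (ord_pred i); rewrite !ffunE ord_predK.
pose r := perm rot_inj.
have rX n f : (r ^+ n)%g f = [ffun i => f (iter n (@ordS _) i)].
  elim: n f => [|n IHn] f; first by rewrite expg0 perm1; apply/ffunP=> i; rewrite ffunE.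
  by rewrite expgS permM IHn permE; apply/ffunP=> i; rewrite !ffunE -iterS.
have itS n (i : 'I_q.+1) : iter n (@ordS _) i = ((i + n) %% q.+1)%N :> nat.
  elim: n => [|n IHn] /=; first by rewrite addn0 modn_small.
  by rewrite IHn -addn1 modnDml -addnA addn1.
have rq : (r ^+ q.+1 = 1)%g.
  apply/permP=> f; rewrite rX perm1; apply/ffunP=> i; rewrite ffunE; congr (f _).
  by apply: ord_inj; rewrite itS modnDr modn_small.
have pr : p.-group <[r]>.
  by rewrite /pgroup -orderE; apply: pnat_dvd pq; rewrite order_dvdn rq.
pose S := [set f : {ffun 'I_q.+1 -> gT} | f \in ffun_on (mem G)].
have rS f : (r f \in S) = (f \in S).
  rewrite !inE permE; apply/ffun_onP/ffun_onP => Gf i; last by rewrite ffunE.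
  by have := Gf (ord_pred i); rewrite ffunE ord_predK.
rewrite (eq_bigl (mem S)); last by move=> f; rewrite !inE.
have rAct : [acts <[r]>, on S | 'P].
  by rewrite cycle_subG !inE /=; apply/subsetP=> f Sf; have:= rS f; rewrite Sf !inE.
have Frot (f : {ffun 'I_q.+1 -> gT}) : f \in S -> F (\prod_i r f i)%g = F (\prod_i f i)%g.
  rewrite inE => /ffun_onP Gf.
  (* Moving the first letter of a word to its end conjugates the product by that letter. *)
  have -> : (\prod_i r f i = (\prod_i f i) ^ f ord0)%g.
    rewrite [RHS]conjgE [in RHS]big_ord_recl /= -mulgA mulKg big_ord_recr /= permE ffunE.
    congr (_ * _)%g; last by congr (f _); apply: val_inj; rewrite /= modnn.
    apply: eq_bigr => i _; rewrite ffunE; congr (f _); apply: val_inj.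
    by rewrite /= modn_small // ltnS.
  by rewrite clF //; apply: group_prod.
have crot (f : {ffun 'I_q.+1 -> gT}) : \prod_i c (r f i) = \prod_i c (f i).
  rewrite [RHS](reindex_inj (@ordS_inj _)) /=.
  by apply: eq_bigr => i _; rewrite permE ffunE.
rewrite (pgroup_sum_fix charkp pr rAct); last first.
  move=> f a Sf /cycleP[n ->] /=; elim: n => [|n IHn]; first by rewrite expg0 /aperm perm1.
  have Srn : (r ^+ n)%g f \in S.
    by elim: (n) => [|n1 IHn1]; rewrite ?expg0 ?perm1 // expgSr permM rS.
  by rewrite -IHn /aperm expgSr permM Frot // crot.
rewrite (reindex_onto (fun x : gT => [ffun _ : 'I_q.+1 => x])
           (fun f : {ffun 'I_q.+1 -> gT} => f ord0)) /=; last first.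
  move=> f; rewrite !inE => /andP[_ /subsetP fixf].
  have /eqP rf : r f == f by have := fixf r (cycle_id r); rewrite inE.
  apply/ffunP=> i; rewrite ffunE.
  have -> : i = iter i (@ordS _) ord0 by apply: ord_inj; rewrite itS add0n modn_small.
  elim: (nat_of_ord i) => //= n ->; by rewrite -[in LHS]rf permE ffunE.
apply: eq_big => [x | x _]; last first.
  rewrite (eq_bigr (fun=> c x)) => [|i _]; last by rewrite ffunE.
  rewrite [in X in F X](eq_bigr (fun=> x)) => [|i _]; last by rewrite ffunE.
  by rewrite prodr_const prodg_const card_ord.
rewrite ffunE eqxx andbT !inE; apply/andP/idP=> [[/ffun_onP/(_ ord0) + _] | Gx].
  by rewrite ffunE.
split; first by apply/ffun_onP=> i; rewrite ffunE.
apply/subsetP=> a /cycleP[n ->]; rewrite inE /= /aperm rX.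
by apply/eqP/ffunP=> i; rewrite !ffunE.
Qed.

End PowerTrace.

Section RegularSupport.

Variables (k : fieldType) (p : nat) (charkp : p \in [pchar k]).
Variable gT : finGroupType.

Definition preg_supported (G : {group gT}) (A : 'M[k]_#|G|) :=
  forall x, x \in G -> ~~ p^'.-elt x -> gring_coef A x = 0.

(* Osima's theorem. At an element with p-part u <> 1 the product is computed  *)
(* in 'C_G(u), where u is central; with s the p'-part and s = s' ^+ q for a   *)
(* large power q of p, (e * s') ^+ q = e * s is a combination of q-th powers  *)
(* modulo commutators, and q-th powers are p-regular.                         *)
Lemma preg_supportedM_idem (G : {group gT}) (A B : 'M[k]_#|G|) :
    (A \in 'Z(group_ring k G))%MS -> preg_supported A ->
    is_central_idempotent B ->
  preg_supported (A *m B).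
Proof.
move=> ZA Apreg [ZB idB] g Gg g_sing; have p_pr := pcharf_prime charkp.
set u := (g.`_p)%g; set s := (g.`_p^')%g.
have Gu : u \in G by exact: groupX.
have Gs : s \in G by exact: groupX.
have sQG : <[u]> \subset G by rewrite cycle_subG.
have pQ : p.-group <[u]> by exact: p_elt_constt.
pose C := 'C_G(<[u]>)%G; have sCG : C \subset G by exact: subsetIl.
have cu x : x \in C -> commute u x.
  by case/setIP=> _ /centP cxQ; apply/commute_sym/cxQ/cycle_id.
have memC x : x \in G -> commute u x -> x \in C.
  by move=> Gx cux; apply/setIP; split=> //; apply/centP=> y /cycleP[n ->]; exact/commuteX/commute_sym.
have Cu : u \in C by exact: memC.
have Cs : s \in C.
  by apply: memC => //; apply/commuteX/commute_sym/commuteX.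
have us : (u * s = g)%g by exact: consttC.
have Cg : g \in C by rewrite -us groupM.
rewrite (gring_coefM_fix charkp pQ) //.
pose e := Brauer_map <[u]> B.
have Re : (e \in group_ring k C)%MS by exact: Brauer_map_mem.
have Ze : (e \in 'Z(group_ring k C))%MS by exact: Brauer_map_center.
have ide : e *m e = e by rewrite -(Brauer_mapM charkp pQ) ?idB.
(* The p-part of the order of C: this power kills the p-part of every element of C. *)
pose q := (p ^ logn p #|C|)%N.
have co_s : coprime #|<[s]>| q.
  rewrite coprime_sym coprimeXl // -orderE.
  have: p^'.-elt s by exact: p_elt_constt.
  by rewrite /p_elt p'natE // => /negP nps; rewrite prime_coprime //; apply/negP.
(* A q-th root of s^-1, as q is prime to the order of s. The inverse is what makes the coefficient
   of e at x reappear as that of e s^-1 at x s^-1. *)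
pose s' := (s^-1 ^+ expg_invn <[s]> q)%g.
have s'q : (s' ^+ q = s^-1)%g.
  by rewrite /s' expgAC (expgK co_s) // groupV cycle_id.
have Cs' : s' \in C by rewrite groupX ?groupV.
pose aC := regular_repr k C.
have Ra x : x \in C -> (aC x \in group_ring k C)%MS by exact: envelop_mx_id.
pose Y := e *m aC s'.
have RY : (Y \in group_ring k C)%MS by rewrite envelop_mxM ?Ra.
have YX n : Y ^+ n.+1 = e *m aC (s' ^+ n.+1)%g.
  elim: n => [|n IHn]; first by rewrite expr1 expg1.
  have Cs'n : (s' ^+ n.+1)%g \in C by exact: groupX.
  rewrite exprS IHn -[LHS]/(Y *m _) /Y mulmxA -(mulmxA e) -(gring_centerC Ze) ?Ra //.
  by rewrite mulmxA ide -mulmxA -repr_mxM // [in RHS]expgS.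
have q_gt0 : (0 < q)%N by rewrite expn_gt0 prime_gt0.
have Yq : Y ^+ q = e *m aC s^-1%g by rewrite -(prednK q_gt0) YX prednK // s'q.
(* A class function on C because u is central there. Paired with e s^-1 it gives the coefficient of
   A B at u s = g. *)
pose F x := gring_coef A (u * x^-1)%g.
have clF : {in C &, forall x y, F (x ^ y)%g = F x}.
  move=> x y Cx Cy; rewrite /F -conjVg -[in LHS](_ : (u ^ y = u)%g).
    rewrite -conjMg; have [_ ->] := (gring_center_coefP A).1 ZA => //.
      by rewrite groupM ?groupV // (subsetP sCG).
    by rewrite (subsetP sCG).
  by apply/conjg_fixP/commgP; apply: cu.
have := class_fun_gring_exp charkp (gring_coef Y) (logn p #|C|) clF.
rewrite -/q -(gring_coefK RY) Yq [in X in _ = X -> _]big1.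
  move=> defS; rewrite -[RHS]defS [RHS](reindex_inj (mulIg s^-1%g)) /=.
  apply: eq_big => [x|x Cx]; first by rewrite groupMr ?groupV.
  rewrite mulrC; congr (_ * _); last first.
    by rewrite /F invMg invgK mulgA us.
  rewrite gring_coefMr ?Ra ?groupM ?groupV // (bigD1 s^-1%g) ?groupV //= big1.
    rewrite addr0 gring_coef_repr ?groupV // eqxx mulr1 mulgK.
    by rewrite Brauer_map_coef.
  by move=> y /andP[Cy ne]; rewrite gring_coef_repr ?groupV // eq_sym (negPf ne) mulr0.
move=> x Cx; rewrite /F Apreg ?mulr0 //.
  by rewrite groupM ?groupV ?groupX // (subsetP sCG).
have p'xq : p^'.-elt ((x ^+ q)^-1)%g.
  rewrite p_eltV p_elt_exp.
  rewrite partnNK p_part dvdn_exp2l // dvdn_leq_log // ?cardG_gt0 //.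
  exact: order_dvdG.
(* The p-part of u (x^q)^-1 is u; were this element p-regular, u would be 1 and g p-regular. *)
apply: contra g_sing => /constt1P; rewrite consttM; last first.
  exact/commuteV/commuteX/cu.
rewrite (constt_p_elt (p_elt_constt _ _)) (constt1P p'xq) mulg1 => u1.
exact/constt1P.
Qed.

End RegularSupport.

(** * Nilpotent matrices and Fitting idempotents *)

Lemma mxtrace_nilpotent (F : closedFieldType) n (N : 'M[F]_n) r :
  N ^+ r = 0 -> \tr N = 0.
Proof.
case: n N => [|n] N nilN; first by rewrite /mxtrace big_ord0.
have [s] := closed_field_poly_normal (char_poly N).
rewrite (monicP (char_poly_monic N)) scale1r => def_s.
have s0 z : z \in s -> z = 0.
  move=> sz; have: eigenvalue N z by rewrite eigenvalue_root_char def_s root_prod_XsubC.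
  case/eigenvalueP=> v vN nzv.
  have: v *m N ^+ r = z ^+ r *: v.
    elim: (r) => [|m IHm]; first by rewrite !expr0 mulmx1 scale1r.
    by rewrite exprSr -mulmxE mulmxA IHm -scalemxAl vN scalerA -exprSr.
  rewrite nilN mulmx0 => /esym/eqP; rewrite scaler_eq0 (negPf nzv) orbF expf_eq0.
  by case/andP=> _ /eqP.
have def_N : char_poly N = 'X^(n.+1).
  have size_s : size s = n.+1.
    by have := size_char_poly N; rewrite def_s size_prod_XsubC => -[].
  rewrite def_s (eq_big_seq (fun=> 'X)) => [|z /s0->]; last by rewrite subr0.
  by rewrite big_const_seq count_predT size_s iter_mulr mulr1.
have := char_poly_trace N isT; rewrite def_N coefXn /= ltn_eqF //.
by move/eqP; rewrite eq_sym oppr_eq0 => /eqP.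
Qed.

(** Fitting's lemma with the idempotent written as a polynomial in N without constant term, so that
    it stays in any algebra containing N. The characteristic polynomial is q X^m with q(0) nonzero,
    and the Bezout relation u q + v X^(m+1) = 1 yields the idempotent X^(m+1) v at N. *)
Lemma fitting_idempotent (F : fieldType) n (N : 'M[F]_n) :
  exists r d (c : nat -> F),
    let U := \sum_(i < d) c i *: N ^+ i in
    [/\ (0 < r)%N, (N ^+ r * U) * (N ^+ r * U) = N ^+ r * U
      & N ^+ r * (N ^+ r * U) = N ^+ r].
Proof.
case: n N => [|n] N.
  by exists 1%N, 0%N, (fun=> 0); split=> //; apply/matrixP=> -[].
have [m [q]] := multiplicity_XsubC (char_poly N) 0.
rewrite (monic_neq0 (char_poly_monic N)) subr0 => /= q0 defP.
have coq : coprimep q ('X ^+ m.+1).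
  by rewrite coprimep_expr // -['X]subr0 coprimep_XsubC.
have [[u v] /= uv] := Bezout_eq1_coprimepP _ _ coq.
have hX : horner_mx N 'X^(m.+1) = N ^+ m.+1 by rewrite rmorphXn /= horner_mx_X.
have hv : \sum_(i < size v) v`_i *: N ^+ i = horner_mx N v.
  rewrite -[v in RHS]coefK poly_def linear_sum; apply: eq_bigr => i _.
  by rewrite linearZ /= rmorphXn /= horner_mx_X.
(* Taking [m.+1] instead of the multiplicity m keeps the exponent positive even when N is
   invertible. *)
exists m.+1, (size v), (fun i => v`_i); rewrite /= hv -hX -!rmorphM /=.
have dX : 'X^(m.+1) * (1 - 'X^(m.+1) * v) = char_poly N * ('X * u).
  have -> : 1 - 'X^(m.+1) * v = u * q by rewrite -uv (mulrC v) addrK.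
  by rewrite defP exprSr (mulrC u) mulrACA [in LHS](mulrC _ q).
have Xf : horner_mx N ('X^(m.+1) * ('X^(m.+1) * v)) = horner_mx N 'X^(m.+1).
  apply/eqP; rewrite eq_sym -subr_eq0 -rmorphB /= -{1}['X^_]mulr1 -mulrBr dX.
  by rewrite rmorphM /= Cayley_Hamilton mul0r.
split=> //; rewrite {1}(mulrC 'X^(m.+1)) -mulrA rmorphM /= Xf -rmorphM /=.
by rewrite mulrC.
Qed.

(** * Blocks with central defect group *)

Section LocalBlocks.

Variables (k : fieldType) (gT : finGroupType) (G : {group gT}).
Local Notation R_G := (group_ring k G).
Implicit Types A B : 'M[k]_#|G|.

Lemma gring_center1 : (1%:M \in 'Z(R_G))%MS.
Proof.
by rewrite sub_capmx envelop_mx1 memmx_cent_envelop; apply/centgmxP=> x _; rewrite mulmx1 mul1mx.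
Qed.

Lemma gring_centerX A n : (A \in 'Z(R_G))%MS -> (A ^+ n \in 'Z(R_G))%MS.
Proof.
move=> ZA; elim: n => [|n IHn]; first exact: gring_center1.
by rewrite exprS; apply: gring_centerM.
Qed.

(** The centre of a block is local: the Fitting idempotent f of y e lies below e, so primitivity
    leaves f = 0, where y e is nilpotent, or f = e, where y is invertible on the block. *)
Lemma block_fitting e y :
    is_block e -> (y \in 'Z(R_G))%MS ->
  (exists r, (y *m e) ^+ r = 0) \/
  (exists2 v, (v \in 'Z(R_G))%MS & e = y *m v).
Proof.
case=> [[Ze ide] _ prim_e] Zy; pose N := y *m e.
have ZN : (N \in 'Z(R_G))%MS by exact: gring_centerM.
have [r [d [c /=]]] := fitting_idempotent N; set U := \sum_i _ => -[r_gt0 idf Nf].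
have ZU : (U \in 'Z(R_G))%MS.
  by rewrite linear_sum summx_sub // => i _; rewrite linearZ scalemx_sub ?gring_centerX.
have Ne : N *m e = N by rewrite /N -mulmxA ide.
have NX m : (0 < m)%N -> N ^+ m = y *m (e *m N ^+ m.-1).
  by case: m => // m _; rewrite exprS mulmxA.
have NXe m : (0 < m)%N -> N ^+ m *m e = N ^+ m.
  by case: m => // m _; rewrite exprSr -[_ * N]/(_ *m N) -mulmxA Ne.
pose f := N ^+ r *m U.
have Zf : (f \in 'Z(R_G))%MS by rewrite gring_centerM ?gring_centerX.
have fe : f *m e = f.
  by rewrite /f -mulmxA (gring_centerC ZU) ?gring_center_mem // mulmxA NXe.
have ef : e *m f = f by rewrite (gring_centerC Ze) ?gring_center_mem.
have [f0|ef0] : f = 0 \/ e - f = 0.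
  have ff : f *m f = f by exact: idf.
  apply: (prim_e f (e - f)).
  - by split.
  - split; first by rewrite linearB addmx_sub // eqmx_opp.
    by rewrite mulmxBl !mulmxBr ide ef fe ff subrr subr0.
  - by rewrite mulmxBr fe ff subrr.
  by rewrite addrC subrK.
- by left; exists r; rewrite -Nf -[_ * U]/f f0 mulr0.
right; exists (e *m N ^+ r.-1 *m U).
  by rewrite !gring_centerM ?gring_centerX.
by rewrite !mulmxA -(mulmxA y) -NX //; apply/eqP; rewrite -subr_eq0 ef0.
Qed.

End LocalBlocks.

(** The scalar w is an eigenvalue of multiplication by a on the row space of e. Thus a - w is not
    invertible on the block, hence nilpotent there by locality. *)
Lemma block_central_char (k : closedFieldType) (gT : finGroupType)
    (G : {group gT}) (e a : 'M[k]_#|G|) :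
    is_block e -> (a \in 'Z(group_ring k G))%MS ->
  exists w r, (a *m e - w *: e) ^+ r = 0.
Proof.
move=> Be Za; have [[Ze ide] nz_e _] := Be.
pose B := row_base e.
have sBe : (B <= e)%MS by rewrite eq_row_base.
have Bee : B *m e = B.
  by have /submxP[D ->] := sBe; rewrite -mulmxA ide.
have sBa : (B *m a <= B)%MS.
  rewrite (eqmxMr a (eq_row_base e)) eq_row_base -(gring_centerC Za) ?gring_center_mem //.
  exact: submxMl.
have /submxP[C defC] := sBa.
have r_gt0 : (0 < \rank e)%N by rewrite lt0n mxrank_eq0; apply/eqP.
have [w rw] : exists w, root (char_poly C) w.
  by apply/closed_rootP; rewrite size_char_poly; case: (\rank e) r_gt0.
move: rw; rewrite -eigenvalue_root_char => /eigenvalueP[v vC nzv].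
have Zy : (a - w%:M \in 'Z(group_ring k G))%MS.
  by rewrite linearB addmx_sub // eqmx_opp -scalemx1 linearZ scalemx_sub ?gring_center1.
exists w; have [[r nil]|[u _ def_e]] := block_fitting Be Zy.
  by exists r; rewrite -mul_scalar_mx -mulmxBl.
have /eqP[] : v *m B != 0 by rewrite mulmx_free_eq0 // row_base_free.
have -> : v *m B = v *m B *m e by rewrite -mulmxA Bee.
rewrite [X in _ *m X]def_e mulmxA mulmxBr -(mulmxA v) defC mulmxA vC mul_mx_scalar.
by rewrite -scalemxAl subrr mul0mx.
Qed.

Section SetMapMatrices.

Variables (R : nzRingType) (T : finType) (S : {set T}).
Implicit Types f g : T -> T.

(** Acts on row vectors, so products compose from left to right; a point that f sends out of S gives
    a zero row. *)
Definition set_map_mx f : 'M[R]_#|S| :=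
  \matrix_(i, j) (f (enum_val i) == enum_val j)%:R.

Lemma set_map_mxM f g :
  {in S, forall x, f x \in S} -> set_map_mx f *m set_map_mx g = set_map_mx (g \o f).
Proof.
move=> Sf; apply/matrixP=> i j; rewrite !mxE /=.
under eq_bigr do rewrite !mxE.
rewrite -(big_enum_val (fun x => (f (enum_val i) == x)%:R * (g x == enum_val j)%:R)).
rewrite (bigD1 (f (enum_val i))) ?Sf ?enum_valP //= eqxx mul1r big1 ?addr0 //.
by move=> x /andP[_ ne]; rewrite eq_sym (negPf ne) mul0r.
Qed.

Lemma eq_set_map_mx f g : {in S, f =1 g} -> set_map_mx f = set_map_mx g.
Proof. by move=> eqf; apply/matrixP=> i j; rewrite !mxE eqf ?enum_valP. Qed.

Lemma set_map_mx1 f : {in S, f =1 id} -> set_map_mx f = 1%:M.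
Proof.
move/eq_set_map_mx->; apply/matrixP=> i j.
by rewrite !mxE (inj_eq enum_val_inj).
Qed.

Lemma mxtrace_set_map f : \tr (set_map_mx f) = \sum_(x in S) (f x == x)%:R.
Proof.
by rewrite (big_enum_val (fun x => (f x == x)%:R)); apply: eq_bigr => i _; rewrite mxE.
Qed.

End SetMapMatrices.

Section RelativeTrace.

Variables (k : fieldType) (gT : finGroupType) (G : {group gT}).
Local Notation R_G := (group_ring k G).
Local Notation aG := (regular_repr k G).
Implicit Types (A B : 'M[k]_#|G|) (H Z : {group gT}).

Lemma gring_conj_mem A x : (A \in R_G)%MS -> x \in G -> (gring_conj A x \in R_G)%MS.
Proof.
by move=> RA Gx; rewrite /gring_conj !envelop_mxM ?envelop_mx_id ?groupV.
Qed.

Lemma gring_coef_conj A :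
  (A \in R_G)%MS ->
  {in G &, forall x g, gring_coef (gring_conj A x) g = gring_coef A (x * g * x^-1)%g}.
Proof.
move=> RA x g Gx Gg; have Gx' := groupVr Gx.
have Ra y : y \in G -> (aG y \in R_G)%MS by exact: envelop_mx_id.
rewrite /gring_conj gring_coefMr ?envelop_mxM ?Ra // (bigD1 x) //= big1; last first.
  by move=> y /andP[Gy ne]; rewrite gring_coef_repr // eq_sym (negPf ne) mulr0.
rewrite addr0 gring_coef_repr // eqxx mulr1 gring_coefM ?Ra ?groupM //.
rewrite (bigD1 x^-1%g) //= big1 => [|y /andP[Gy ne]]; last first.
  by rewrite gring_coef_repr // eq_sym (negPf ne) mul0r.
by rewrite addr0 gring_coef_repr // eqxx mul1r invgK mulgA.
Qed.

Lemma rel_trace_mem H A :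
  H \subset G -> (A \in R_G)%MS -> (rel_trace H A \in R_G)%MS.
Proof.
move=> sHG RA; rewrite linear_sum summx_sub // => X HX.
by rewrite gring_conj_mem ?(repr_rcosets_mem HX).
Qed.

Lemma gring_coef_rel_trace H A g :
    H \subset G -> (A \in R_G)%MS -> g \in G ->
  gring_coef (rel_trace H A) g =
  coset_sum H G (fun x => gring_coef A (x * g * x^-1)%g).
Proof.
move=> sHG RA Gg; rewrite gring_coef_sum; apply: eq_bigr => X HX.
by rewrite gring_coef_conj // (repr_rcosets_mem HX).
Qed.

Lemma rel_traceMr H A B :
  H \subset G -> (B \in 'Z(R_G))%MS -> rel_trace H (A *m B) = rel_trace H A *m B.
Proof.
move=> sHG ZB; rewrite [RHS]mulmx_suml; apply: eq_bigr => X HX.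
have Gx := repr_rcosets_mem HX sHG.
rewrite /gring_conj -!mulmxA; congr (_ *m (_ *m _)).
by rewrite (gring_centerC ZB) // envelop_mx_id.
Qed.

Lemma rel_trace_center Z A :
  Z \subset 'Z(G) -> (A \in R_G)%MS -> (rel_trace Z A \in 'Z(R_G))%MS.
Proof.
move=> sZZ RA; have sZG := subset_trans sZZ (center_sub G).
apply/gring_center_coefP; split=> [|g y Gg Gy]; first exact: rel_trace_mem.
rewrite !gring_coef_rel_trace ?groupJ //.
pose f x := gring_coef A (x * g * x^-1)%g.
have fZ : left_invariant Z G f.
  move=> z x Zz Gx; rewrite /f; congr (gring_coef A _).
  have /centerP[_ cz] := subsetP sZZ z Zz.
  by rewrite invMg !mulgA -(mulgA z) -(mulgA z) cz ?mulgK ?groupM ?groupV.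
rewrite -(coset_sumMr sZG fZ (groupVr Gy)); apply: eq_coset_sum => // x Gx.
by rewrite /f conjgE invMg invgK !mulgA.
Qed.

End RelativeTrace.

Section CentralTrace.

Variables (k : closedFieldType) (gT : finGroupType) (G Z : {group gT}).
Hypothesis sZZ : Z \subset 'Z(G).
Local Notation R_G := (group_ring k G).

Let sZG : Z \subset G := subset_trans sZZ (center_sub G).

Let cZ zeta x : zeta \in Z -> x \in G -> commute zeta x.
Proof. by move/(subsetP sZZ)/centerP=> [_ cz]; apply: cz. Qed.

Let rcosetMl x h : x \in G -> h \in G -> (h *: (Z :* x) = Z :* (h * x))%g.
Proof.
move=> Gx Gh; have nZh : h \in 'N(Z).
  rewrite inE; apply/subsetP=> _ /imsetP[zeta Zz ->].
  by rewrite conjgE (cZ Zz Gh) mulKg.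
by rewrite rcosetM (norm_rlcoset nZh) mulgA.
Qed.

(** Left and right translations on k[G / Z]. The inverse makes [lmul] multiplicative in the row
    convention. *)
Let lmul (h : gT) := @set_map_mx k _ (rcosets Z G) (fun X => (h^-1 *: X)%g).
Let rmul (g : gT) := @set_map_mx k _ (rcosets Z G) (fun X => X :* g).

Let lmul_repr : mx_repr G lmul.
Proof.
split=> [|h h' Gh Gh'].
  by apply: set_map_mx1 => X _; rewrite invg1 lcoset1.
rewrite set_map_mxM.
  by apply: eq_set_map_mx => X _ /=; rewrite invMg lcosetM.
move=> _ /rcosetsP[x Gx ->]; rewrite rcosetMl ?groupV //.
by rewrite -rcosetE imset_f ?groupM ?groupV.
Qed.

(* The sum of the coefficients of w along Z g is the trace of an operator on  *)
(* k[G / Z], which is nilpotent if w = A *m z with z central nilpotent.       *)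
Lemma trace_form_nilpotent A z g r :
    (A \in R_G)%MS -> (z \in 'Z(R_G))%MS -> z ^+ r = 0 -> g \in G ->
  \sum_(zeta in Z) gring_coef (rel_trace Z (A *m z)) (zeta * g)%g = 0.
Proof.
move=> RA Zz nil_z Gg; have Rz := gring_center_mem Zz.
pose rL := MxRepresentation lmul_repr.
have RAz : (A *m z \in R_G)%MS by rewrite envelop_mxM.
pose N := gring_op rL (A *m z) *m rmul g.
have opX n : gring_op rL (z ^+ n) = gring_op rL z ^+ n.
  elim: n => [|n IHn]; first by rewrite !expr0 gring_op1.
  by rewrite !exprSr -[_ * z]/(_ *m z) gring_opM // IHn.
have czr : gring_op rL z *m rmul g = rmul g *m gring_op rL z.
  rewrite gring_op_coef // mulmx_suml mulmx_sumr; apply: eq_bigr => h Gh.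
  rewrite -scalemxAl -scalemxAr; congr (_ *: _); rewrite /rL /= /lmul /rmul.
  rewrite !set_map_mxM => [|X HX|X HX].
  - by apply: eq_set_map_mx => X _ /=; rewrite mulgA.
  - by have [x Gx ->] := rcosetsP HX; rewrite -rcosetM -rcosetE imset_f ?groupM.
  have [x Gx ->] := rcosetsP HX; rewrite rcosetMl ?groupV //.
  by rewrite -rcosetE imset_f ?groupM ?groupV.
have N_nil : N ^+ r = 0.
  have -> : N = (gring_op rL A *m rmul g) * gring_op rL z.
    by rewrite -[RHS]mulmxA -czr mulmxA -gring_opM.
  rewrite exprMn_comm; first by rewrite -opX nil_z linear0 mulr0.
  rewrite /GRing.comm -[LHS]mulmxA -czr !mulmxA -gring_opM //.
  rewrite -(gring_centerC Zz) // gring_opM //.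
  by rewrite -[RHS]/(_ *m _) mulmxA.
have := mxtrace_nilpotent N_nil.
rewrite /N (gring_op_coef _ RAz) mulmx_suml linear_sum /= => trN.
rewrite -[RHS]trN.
transitivity (\sum_(X in rcosets Z G) \sum_(zeta in Z)
    gring_coef (A *m z) (zeta * (repr X * g * (repr X)^-1))%g).
  rewrite exchange_big /=; apply: eq_bigr => zeta Zzeta.
  have Gzeta := subsetP sZG zeta Zzeta.
  rewrite gring_coef_rel_trace ?groupM //; apply: eq_bigr => X HX.
  have Gx := repr_rcosets_mem HX sZG.
  by rewrite !mulgA (cZ Zzeta Gx).
(* For X = Z x the diagonal entry of the h-term is 1 exactly when h lies in Z x g x^-1, the range of
   the previous sum. *)
transitivity (\sum_(h in G) \sum_(X in rcosets Z G)
    gring_coef (A *m z) h * ((h^-1 *: X)%g :* g == X)%:R); last first.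
  apply: eq_bigr => h Gh; rewrite -scalemxAl linearZ /= -mulr_sumr; congr (_ * _).
  rewrite /rL /= /lmul /rmul set_map_mxM ?mxtrace_set_map // => X HX.
  have [x Gx ->] := rcosetsP HX; rewrite rcosetMl ?groupV //.
  by rewrite -rcosetE imset_f ?groupM ?groupV.
rewrite [RHS]exchange_big /=; apply: eq_bigr => X HX.
have Gx := repr_rcosets_mem HX sZG; set x := repr X in Gx *.
have defX : X = Z :* x by rewrite /x; case/rcosetsP: HX => y _ ->; rewrite rcoset_repr.
set y := (x * g * x^-1)%g; have Gy : y \in G by rewrite !groupM ?groupV.
under [RHS]eq_bigr do rewrite mulr_natr mulrb.
rewrite -big_mkcondr /= [RHS](reindex_onto (fun h => h * y)%g (fun h => h * y^-1)%g) /=.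
  apply: eq_bigl => h; rewrite mulgK eqxx andbT groupMr //.
  case Gh: (h \in G) => /=; last first.
    by apply/negP=> Zh; rewrite (subsetP sZG) in Gh.
  have Ghy : (h * y)^-1%g \in G by rewrite groupV groupM.
  rewrite defX rcosetMl // -(rcosetM Z) (sameP eqP rcoset_eqP).
  rewrite mem_rcoset -!mulgA -/y invMg -mulgA.
  have -> : (y^-1 * (h^-1 * (x * (g * x^-1))) = h^-1 ^ y)%g by rewrite conjgE /y !mulgA.
  by rewrite memJ_norm ?groupV // (subsetP _ y Gy) // cents_norm // centsC (subset_trans sZZ) ?subsetIr.
by move=> h _; rewrite mulgKV.
Qed.

End CentralTrace.

Lemma coset_sum_mulrn (gT : finGroupType) (V : nmodType) (H G : {group gT})
    (f : gT -> V) :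
    H \subset G -> left_invariant H G f ->
  coset_sum H G f *+ #|H| = \sum_(x in G) f x.
Proof.
move=> sHG fH; rewrite -sumrMnl.
rewrite [RHS](partition_big (fun x => H :* x)%g (mem (rcosets H G))) /=; last first.
  by move=> x Gx; rewrite -rcosetE imset_f.
apply: eq_bigr => X HX; have Gx := repr_rcosets_mem HX sHG.
have defX : X = (H :* repr X)%g by case/rcosetsP: HX => y _ ->; rewrite rcoset_repr.
rewrite -(card_rcoset H (repr X)) -defX -sumr_const; apply: eq_big => x.
  apply/idP/andP=> [Xx|[Gx' /eqP <-]]; last exact: rcoset_refl.
  split; last by rewrite defX (sameP eqP rcoset_eqP) -defX.
  by move: Xx; rewrite defX => /rcosetP[h Hh ->]; rewrite groupM // (subsetP sHG).
move=> Xx; have /rcosetP[h Hh ->] : x \in (H :* repr X)%g by rewrite -defX.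
by rewrite fH.
Qed.

Section CentralDefect.

Variables (k : fieldType) (p : nat) (charkp : p \in [pchar k]).
Variables (gT : finGroupType) (G Z : {group gT}).
Hypotheses (sZZ : Z \subset 'Z(G)) (pZ : p.-group Z).
Local Notation R_G := (group_ring k G).
Local Notation aG := (regular_repr k G).

(** Each class in the support is concentrated at one element y, with weight e(y) / |C_G(y) : Z|. The
    trace from Z reaches each conjugate of y exactly |C_G(y) : Z| times, and this index is prime to
    p because Z contains a Sylow p-subgroup of C_G(y). Off the support the index may vanish in k,
    but the weight is 0 anyway. *)
Lemma rel_trace_of_support (e : 'M[k]_#|G|) :
    (e \in 'Z(R_G))%MS ->
    (forall x (D : {group gT}), x \in G -> gring_coef e x != 0 ->
       p.-group D -> D \subset 'C_G[x] -> D \subset Z) ->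
  exists2 A, (A \in R_G)%MS & e = rel_trace Z A.
Proof.
case/gring_center_coefP=> Re cl_e suppe.
have sZG : Z \subset G := subset_trans sZZ (center_sub G).
pose c y := if y == repr (y ^: G) then gring_coef e y / (#|'C_G[y] : Z|)%:R else 0.
exists (\sum_(y in G) c y *: aG y); first exact: gring_comb_mem.
apply: gring_coef_inj => //; first by rewrite rel_trace_mem ?gring_comb_mem.
move=> g Gg; rewrite gring_coef_rel_trace ?gring_comb_mem //.
pose y0 := repr (g ^: G).
have [t Gt def_y0] : exists2 t, t \in G & y0 = (g ^ t)%g.
  by apply/imsetP; exact: mem_repr (class_refl G g).
have Gy0 : y0 \in G by rewrite def_y0 groupJ.
have sZC : Z \subset 'C_G[y0].
  rewrite subsetI sZG sub_cent1 (subsetP _ y0 Gy0) // centsC.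
  by rewrite (subset_trans sZZ) ?subsetIr.
pose n := coset_sum Z G (fun x => (x * g * x^-1 == y0 : nat))%g.
transitivity (gring_coef e y0 / (#|'C_G[y0] : Z|)%:R * n%:R); last first.
  rewrite /n /coset_sum natr_sum mulr_sumr; apply: eq_bigr => X HX.
  have Gx := repr_rcosets_mem HX sZG; set x := repr X in Gx *.
  have Gxg : (x * g * x^-1)%g \in G by rewrite !groupM ?groupV.
  rewrite gring_coef_comb // /c.
  have -> : repr ((x * g * x^-1) ^: G)%g = y0.
    rewrite /y0; congr repr; apply/class_eqP.
    by apply/imsetP; exists x^-1%g; rewrite ?groupV // conjgE invgK mulgA.
  by case: eqP => [->|_]; rewrite ?mulr1 ?mulr0.
have -> : gring_coef e g = gring_coef e y0 by rewrite def_y0 cl_e.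
have [->|nz_e] := eqVneq (gring_coef e y0) 0; first by rewrite !mul0r.
have -> : n = #|'C_G[y0] : Z|.
  apply/eqP; rewrite -(eqn_pmul2r (cardG_gt0 Z)) [in X in _ == X]mulnC Lagrange //.
  have := @coset_sum_mulrn gT nat Z G (fun x => (x * g * x^-1 == y0 : nat))%g sZG.
  rewrite -/n -mulr_natr natn -[_ * _]/(_ * _)%N => -> => [|h x Zh Gx].
    rewrite -(card_rcoset 'C_G[y0] t^-1) -sum1_card big_mkcond [X in _ == X]big_mkcond.
    apply/eqP/eq_bigr => x _; rewrite mem_rcoset invgK inE.
    have [Gx|nGx] := boolP (x \in G); last by rewrite groupMr // (negPf nGx).
    rewrite groupM //= cent1E.
    have -> : (x * t * y0 == y0 * (x * t))%g = (x * g * x^-1 == y0)%g.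
      rewrite {1}def_y0 conjgE !mulgA mulgK (inj_eq (mulIg t)).
      by rewrite -[RHS](inj_eq (mulIg x)) mulgKV.
    by case: eqP.
  congr (nat_of_bool (_ == _)); have Gy : (x * g * x^-1)%g \in G by rewrite !groupM ?groupV.
  have /centerP[_ ch] := subsetP sZZ h Zh.
  by rewrite invMg !mulgA -(mulgA h) -(mulgA h) ch // mulgK.
rewrite mulfVK // -(dvdn_pcharf charkp) -p'natE ?(pcharf_prime charkp) //.
have [D sylD] := Sylow_exists p 'C_G[y0].
have sDZ : D \subset Z by apply: suppe (pHall_pgroup sylD) (pHall_sub sylD).
by rewrite (sub_pHall sylD pZ sDZ sZC); case/and3P: sylD.
Qed.

End CentralDefect.

Lemma preg_supported1 (k : fieldType) (p : nat) (gT : finGroupType)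
    (G : {group gT}) : @preg_supported k p gT G 1%:M.
Proof.
move=> x Gx p_sing; rewrite -(repr_mx1 (regular_repr k G)) gring_coef_repr //.
by case: eqP => // x1; rewrite -x1 p_elt1 in p_sing.
Qed.

(* Up to a nilpotent z, a acts on the block as a scalar w, and z is again     *)
(* p-regularly supported and a trace from Z. By trace_form_nilpotent its      *)
(* coefficients sum to 0 on Z g, where only the p-regular g contributes.      *)
Lemma central_defect_preg_scalar (k : closedFieldType) (p : nat)
    (gT : finGroupType) (G Z : {group gT}) (e a : 'M[k]_#|G|) :
    p \in [pchar k] -> Z \subset 'Z(G) -> p.-group Z -> is_block e ->
    (forall x (D : {group gT}), x \in G -> gring_coef e x != 0 ->
       p.-group D -> D \subset 'C_G[x] -> D \subset Z) ->
    (a \in 'Z(group_ring k G))%MS -> preg_supported p a ->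
  exists w, a *m e = w *: e.
Proof.
move=> charkp sZZ pZ Be suppe Za preg_a; have [[Ze ide] _ _] := Be.
have sZG : Z \subset G := subset_trans sZZ (center_sub G).
have [A RA def_e] := rel_trace_of_support charkp sZZ pZ Ze suppe.
have [w [r nil_z]] := block_central_char Be Za.
exists w; apply/eqP; rewrite -subr_eq0; apply/eqP; set z := _ - _ in nil_z *.
have Zz : (z \in 'Z(group_ring k G))%MS.
  by rewrite linearB addmx_sub ?gring_centerM // eqmx_opp linearZ scalemx_sub.
have def_z : z = rel_trace Z (A *m z).
  rewrite rel_traceMr // -def_e (gring_centerC Ze) ?gring_center_mem //.
  by rewrite mulmxBl -mulmxA -scalemxAl ide.
have preg_ae := preg_supportedM_idem charkp Za preg_a (conj Ze ide).
have preg_e : preg_supported p e.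
  rewrite -[e]mul1mx; apply: (preg_supportedM_idem charkp) => //.
    exact: gring_center1.
  exact: preg_supported1.
have preg_z : preg_supported p z.
  move=> x Gx p_sing; rewrite gring_coefB gring_coefZ preg_ae // preg_e //.
  by rewrite mulr0 subrr.
apply: gring_coef_inj; rewrite ?gring_center_mem //; first by rewrite linear0 sub0mx.
move=> g Gg; have -> : gring_coef (0 : 'M[k]_#|G|) g = 0 by rewrite gring_coefE mxE.
have [p'g|] := boolP (p^'.-elt g); last by move/(preg_z _ Gg).
have := trace_form_nilpotent sZZ RA Zz nil_z Gg.
rewrite -def_z (bigD1 1%g) //= big1 ?addr0 ?mul1g // => zeta /andP[Zzeta ne1].
have Gzeta := subsetP sZG zeta Zzeta.
apply: preg_z; first by rewrite groupM.
apply: contra ne1 => /constt1P.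
have czg : commute zeta g by have /centerP[_] := subsetP sZZ zeta Zzeta; apply.
rewrite consttM // (constt1P p'g) mulg1 constt_p_elt ?(mem_p_elt pZ) //.
by move=> ->.
Qed.

(** * Relatively projective constituents *)

Section DensityLemmas.

Variables (k : fieldType) (gT : finGroupType) (G : {group gT}).
Local Notation R_G := (group_ring k G).
Local Notation aG := (regular_repr k G).

(** Schur's lemma through the image of T, a nonzero submodule. With f a bare function, a conjugate
    of a representation can be used without being packaged. *)
Lemma intertwiner_unit n (rG : mx_representation k G n) (f : gT -> 'M[k]_n) T :
    mx_irreducible rG -> T != 0 -> {in G, forall x, f x *m T = T *m rG x} ->
  T \in unitmx.
Proof.
move=> /mx_irrP[_ irr] nzT fT; rewrite -row_full_unit; apply: irr => //.
by apply/mxmoduleP=> x Gx; rewrite -fT ?submxMl.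
Qed.

(** Linear algebra decides the alternative: the second structure map, restricted to the kernel of
    the first, is zero or has a nonzero row. *)
Lemma gring_op_sub_kernel n1 n2 (r1 : mx_representation k G n1)
    (r2 : mx_representation k G n2) :
    (forall u, (u \in R_G)%MS -> gring_op r1 u = 0 -> gring_op r2 u = 0) \/
    (exists u, [/\ (u \in R_G)%MS, gring_op r1 u = 0 & gring_op r2 u != 0]).
Proof.
pose E1 := enveloping_algebra_mx r1; pose E2 := enveloping_algebra_mx r2.
have [eq0|] := eqVneq (kermx E1 *m E2) 0.
  left=> u Ru; rewrite !gring_opE /gring_mx /= => /(congr1 mxvec).
  rewrite vec_mxK linear0 => /sub_kermxP/submxP[D ->].
  by rewrite -mulmxA eq0 mulmx0 linear0.
case/rowV0Pn=> _ /submxP[D ->] nz; right; exists (gring_mx aG (D *m kermx E1)).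
split; first exact: gring_mxP.
  by rewrite gring_op_mx /gring_mx /= -mulmxA mulmx_ker mulmx0 linear0.
by rewrite gring_op_mx /gring_mx /= -mulmxA vec_mx_eq0.
Qed.

Lemma mulmx3_neq0 m n p q (A : 'M[k]_(m, n)) (B : 'M[k]_(p, q)) :
  A != 0 -> B != 0 -> exists i j, A *m delta_mx i j *m B != 0.
Proof.
case/matrix0Pn=> i [j nzA] /matrix0Pn[r [s nzB]]; exists j, r.
apply/matrix0Pn; exists i, s; rewrite -(mul_delta_mx (0 : 'I_1)) mulmxA -colE.
by rewrite -mulmxA -rowE mxE big_ord1 !mxE mulf_neq0.
Qed.

Section OneRepresentation.

Variables (n : nat) (rG : mx_representation k G n).
Hypothesis absG : mx_absolutely_irreducible rG.

(** Burnside's theorem: kG maps onto the full matrix algebra. *)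
Lemma gring_op_section :
  exists s : 'M[k]_n -> 'M[k]_#|G|, forall M, (s M \in R_G)%MS /\ gring_op rG (s M) = M.
Proof.
have [_ [a_ defA]] := mx_abs_irrP absG.
exists (fun M => \sum_(x in G) a_ x M *: aG x) => M; split.
  exact: gring_comb_mem.
rewrite gring_op_coef ?gring_comb_mem // [RHS]defA.
by apply: eq_bigr => x Gx; rewrite gring_coef_comb.
Qed.

End OneRepresentation.

(** By the inclusion of kernels, r2 becomes a module over the full matrix algebra that is the image
    of r1. Lifted matrix units then transport the standard basis of r1 into r2 and give an
    isomorphism. *)
Lemma gring_kernel_intertwiner n (r1 r2 : mx_representation k G n) :
    mx_absolutely_irreducible r1 -> mx_irreducible r2 ->
    (forall u, (u \in R_G)%MS -> gring_op r1 u = 0 -> gring_op r2 u = 0) ->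
  {in G, forall x, \tr (r1 x) = \tr (r2 x)}.
Proof.
move=> abs1 irr2 ker12; have [s sP] := gring_op_section abs1.
have Rs M : (s M \in R_G)%MS by case: (sP M).
have r1s M : gring_op r1 (s M) = M by case: (sP M).
have [a nz_a] : exists a, gring_op r2 (s (delta_mx a a)) != 0.
  apply/existsP; rewrite -negb_forall; apply/forallP=> r2s.
  have: gring_op r2 (1%:M - \sum_a s (delta_mx a a)) = 0.
    apply: ker12.
      rewrite linearB addmx_sub ?eqmx_opp //; first exact: envelop_mx1.
      by rewrite linear_sum summx_sub // => a _; apply: Rs.
    rewrite linearB /= gring_op1 linear_sum (eq_bigr (fun a => delta_mx a a)) => [|a _]; last exact: r1s.
    by rewrite -mx1_sum_delta subrr.
  rewrite linearB /= gring_op1 linear_sum big1 => [|a _]; last exact/eqP/r2s.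
  have /mx_irrP[n_gt0 _] := irr2.
  move/(congr1 (fun M : 'M_n => M (Ordinal n_gt0) (Ordinal n_gt0))).
  by rewrite subr0 !mxE eqxx => /eqP; rewrite oner_eq0.
have [b nz_b] : exists b, row b (gring_op r2 (s (delta_mx a a))) != 0.
  case/matrix0Pn: nz_a => b [c nz_bc]; exists b; apply: contraNneq nz_bc => /rowP/(_ c).
  by rewrite !mxE => ->.
(* Row i is the image of the basis vector b under a lift of the matrix unit (a, i); the choice of a
   and b makes row a nonzero. *)
pose T := \matrix_i row b (gring_op r2 (s (delta_mx a i))).
have nzT : T != 0 by apply: contraNneq nz_b => T0; rewrite -[row b _](rowK (fun i => row b (gring_op r2 (s (delta_mx a i)))) a) -/T T0 row0.
have eqT : {in G, forall x, r1 x *m T = T *m r2 x}.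
  move=> x Gx; apply/row_matrixP=> i; rewrite !row_mul rowK mulmx_sum_row.
  pose v := s (delta_mx a i) *m aG x - \sum_l r1 x i l *: s (delta_mx a l).
  have Rv : (v \in R_G)%MS.
    rewrite linearB addmx_sub ?eqmx_opp //; first by rewrite envelop_mxM ?Rs ?envelop_mx_id.
    by rewrite linear_sum summx_sub // => l _; rewrite linearZ scalemx_sub ?Rs.
  have /(congr1 (row b)) : gring_op r2 v = 0.
    apply: ker12 => //; rewrite linearB /= gring_opM ?envelop_mx_id // gring_opG // r1s.
    rewrite linear_sum; under eq_bigr do rewrite linearZ /= r1s.
    rewrite -(mul_delta_mx (0 : 'I_1)) -mulmxA -rowE [row i _]row_sum_delta mulmx_sumr.
    apply/eqP; rewrite subr_eq0; apply/eqP/eq_bigr => l _.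
    by rewrite -scalemxAr mul_delta_mx mxE.
  rewrite linearB /= gring_opM ?envelop_mx_id // gring_opG // linearB /= row0.
  rewrite row_mul => /eqP; rewrite subr_eq0 => /eqP->.
  rewrite !linear_sum; apply: eq_bigr => l _; rewrite rowK !linearZ /=.
  by rewrite !mxE.
have Tu := intertwiner_unit irr2 nzT eqT.
by move=> x Gx; rewrite -[r1 x](mulmxK Tu) eqT // mxtrace_mulC mulKmx.
Qed.

End DensityLemmas.

Section ConjugateRepresentation.

Variables (k : fieldType) (gT : finGroupType) (H : {group gT}) (d : nat).
Variables (rW : mx_representation k H d) (n : gT).
Hypothesis nHn : n \in 'N(H).

Definition conj_mx h := rW (h ^ n^-1)%g.

Lemma conj_mx_repr : mx_repr H conj_mx.
Proof.
split=> [|x y Hx Hy]; first by rewrite /conj_mx conj1g repr_mx1.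
by rewrite /conj_mx conjMg repr_mxM ?memJ_norm ?groupV.
Qed.

Definition conj_repr := MxRepresentation conj_mx_repr.

Lemma conj_repr_abs_irr :
  mx_absolutely_irreducible rW -> mx_absolutely_irreducible conj_repr.
Proof.
case/mx_abs_irrP=> d_gt0 [a_ defA]; apply/mx_abs_irrP; split=> //.
exists (fun x => a_ (x ^ n^-1)%g) => A; rewrite {1}[A]defA.
by rewrite (reindex_acts 'J _ (groupVr nHn)) ?astabsJ ?normG.
Qed.

End ConjugateRepresentation.

Section ProjectiveConstituent.

Variables (k : closedFieldType) (gT : finGroupType) (N H Z : {group gT}).
Hypotheses (nHN : N \subset 'N(H)) (nZN : N \subset 'N(Z)) (sZH : Z \subset H).
Variables (m : nat) (E : mx_representation k H m).
Hypothesis E_Z : forall z, z \in Z -> E z = 1%:M.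
Local Notation R_H := (group_ring k H).
Local Notation csum := (coset_sum Z H).

Section Constituent.

Variables (d : nat) (rW : mx_representation k H d) (iW : 'M[k]_(d, m)).
Hypotheses (absW : mx_absolutely_irreducible rW) (freeW : row_free iW).
Hypothesis homW : {in H, forall h, rW h *m iW = iW *m E h}.

Let irrW : mx_irreducible rW := mx_abs_irrW absW.

Let rW_Z z : z \in Z -> rW z = 1%:M.
Proof.
move=> Zz; apply: (row_free_inj freeW).
by rewrite homW ?(subsetP sZH) // E_Z // mulmx1 mul1mx.
Qed.

Let rW_conjZ n z : n \in N -> z \in Z -> rW (z ^ n)%g = 1%:M.
Proof. by move=> Nn Zz; rewrite rW_Z // memJ_norm // (subsetP nZN). Qed.

Let memHJ n h : n \in N -> (h ^ n \in H)%g = (h \in H).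
Proof. by move=> Nn; rewrite memJ_norm // (subsetP nHN). Qed.

(** The character of the n-conjugate of W, extended by 0 outside H so that conjugates can be
    compared by equality of finite functions. *)
Let chi n : {ffun gT -> k} :=
  [ffun h => if h \in H then \tr (rW (h ^ n^-1)%g) else 0].

Let orb := undup [seq chi n | n <- enum N].

(** An N-stable function, modelled on the coefficients of the central idempotent of an N-orbit of
    characters. Each conjugate counts once, since the multiplicity with which N repeats it could be
    divisible by p. *)
Let theta h := \sum_(x <- orb) x (h^-1)%g.

Let mem_orb x : reflect (exists2 n, n \in N & x = chi n) (x \in orb).
Proof.
rewrite mem_undup; apply: (iffP mapP) => [[n] | [n]].
  by rewrite mem_enum; exists n.
by exists n; rewrite ?mem_enum.
Qed.

Let theta_conj h n : h \in H -> n \in N -> theta (h ^ n)%g = theta h.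
Proof.
move=> Hh Nn; rewrite /theta.
pose act (n1 : gT) (x : {ffun gT -> k}) := [ffun h1 => x (h1 ^ n1)%g] : {ffun gT -> k}.
have actK n1 : cancel (act n1) (act n1^-1%g).
  by move=> x; apply/ffunP=> h1; rewrite !ffunE conjgKV.
have act_chi n1 n2 : n2 \in N -> act n2 (chi n1) = chi (n1 * n2^-1)%g.
  by move=> Nn2; apply/ffunP=> h1; rewrite !ffunE memHJ // invMg invgK conjgM.
have perm_act : perm_eq orb (map (act n) orb).
  apply: uniq_perm; rewrite ?undup_uniq ?map_inj_uniq ?undup_uniq //.
    exact: can_inj (actK n).
  move=> x; apply/mem_orb/mapP=> [[n1 Nn1 ->] | [_ /mem_orb[n1 Nn1 ->] ->]].
    exists (chi (n1 * n)%g); last by rewrite act_chi // mulgK.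
    by apply/mem_orb; exists (n1 * n)%g; rewrite ?groupM.
  by rewrite act_chi //; exists (n1 * n^-1)%g; rewrite ?groupM ?groupV.
rewrite [RHS](perm_big _ perm_act) big_map /=; apply: eq_bigr => x _.
by rewrite ffunE conjVg.
Qed.

Let chiZ n z h : n \in N -> z \in Z -> h \in H ->
  chi n ((z * h)^-1)%g = chi n (h^-1)%g.
Proof.
move=> Nn Zz Hh; have Hz := subsetP sZH z Zz; have Nn' := groupVr Nn.
rewrite !ffunE groupV groupM // groupV Hh invMg conjMg.
rewrite repr_mxM ?memHJ ?groupV //.
by rewrite [rW (z^-1 ^ _)%g]rW_conjZ ?groupV // mulmx1.
Qed.

Let thetaZ z h : z \in Z -> h \in H -> theta (z * h)%g = theta h.
Proof.
move=> Zz Hh; apply: eq_big_seq => x /mem_orb[n Nn ->]; exact: chiZ.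
Qed.

Let Y i j := csum (fun h => rW (h^-1)%g i j *: E h).

(** Composed with the embedding [iW], the trace of phi is a combination of the [Y i j]; if these all
    vanished, so would [iW]. *)
Let coef_neq0 phi :
    csum (fun h => E (h^-1)%g *m phi *m E h) = 1%:M -> exists i j, Y i j != 0.
Proof.
move=> phi1; have /mx_irrP[d_gt0 _] := irrW.
have [Y0|] := altP (@forallP _ (fun ij => Y ij.1 ij.2 == 0)); last first.
  by rewrite negb_forall => /existsP[[i j] nzY]; exists i, j.
have iW0 : iW = 0.
  rewrite -[iW]mulmx1 -phi1 mulmx_sumr.
  rewrite (eq_bigr (fun X => rW (repr X)^-1%g *m (iW *m phi) *m E (repr X))).
    apply/row_matrixP=> i; rewrite row0 linear_sum /=.
    transitivity (\sum_j row j (iW *m phi) *m Y i j); last first.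
      by rewrite big1 // => j _; rewrite (eqP (Y0 (i, j))) mulmx0.
    under [RHS]eq_bigr do rewrite mulmx_sumr; rewrite exchange_big /=.
    apply: eq_bigr => X _; rewrite -mulmxA row_mul mulmx_sum_row.
    by apply: eq_bigr => j _; rewrite mxE row_mul -scalemxAr.
  move=> X HX; have Gx := repr_rcosets_mem HX sZH.
  by rewrite !mulmxA -homW ?groupV.
have := freeW; rewrite iW0 /row_free mxrank0 => /eqP d0.
by rewrite -d0 in d_gt0.
Qed.

(** The action of kH on the n-conjugate of W, written out for every n because [conj_repr] carries a
    proof that n normalizes H. *)
Let opn n (u : 'M[k]_#|H|) := \sum_(g in H) gring_coef u g *: rW (g ^ n^-1)%g.

Let opnE n u (Nn : n \in N) : (u \in R_H)%MS ->
  opn n u = gring_op (conj_repr rW (subsetP nHN n Nn)) u.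
Proof. by move=> Ru; rewrite gring_op_coef. Qed.

Let opn1 u : (u \in R_H)%MS -> opn 1%g u = gring_op rW u.
Proof.
move=> Ru; rewrite gring_op_coef //.
by apply: eq_bigr => g _; rewrite invg1 conjg1.
Qed.

Let opnM n u v : n \in N -> (u \in R_H)%MS -> (v \in R_H)%MS ->
  opn n (u *m v) = opn n u *m opn n v.
Proof.
by move=> Nn Ru Rv; rewrite !(opnE Nn) ?envelop_mxM // gring_opM.
Qed.

Let sep1 n : n \in N -> chi n != chi 1%g ->
  exists u, [/\ (u \in R_H)%MS, opn n u = 0 & gring_op rW u != 0].
Proof.
move=> Nn ne; pose rn := conj_repr rW (subsetP nHN n Nn).
case: (gring_op_sub_kernel rn rW) => [ker_n | [u [Ru u0 nzu]]]; last first.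
  by exists u; rewrite (opnE Nn).
have eqtr := gring_kernel_intertwiner (conj_repr_abs_irr (subsetP nHN n Nn) absW) irrW ker_n.
case/eqP: ne; apply/ffunP=> h; rewrite !ffunE invg1 conjg1.
by case: ifP => // Hh; apply: eqtr.
Qed.

(** Elements killing the conjugates one at a time are multiplied together; a lifted matrix unit put
    between the factors keeps the product nonzero on W. *)
Let sep_seq (s : seq gT) : {subset s <= [pred n in N | chi n != chi 1%g]} ->
  exists u, [/\ (u \in R_H)%MS, gring_op rW u != 0 & {in s, forall n, opn n u = 0}].
Proof.
have [sc scP] := gring_op_section absW.
elim: s => [|n s IHs] Ns.
  exists 1%:M; split=> //; first exact: envelop_mx1.
  have /mx_irrP[d_gt0 _] := irrW; rewrite gring_op1.
  by rewrite -mxrank_eq0 mxrank1 -lt0n.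
have [|u [Ru nzu su]] := IHs; first by move=> x sx; apply: Ns; rewrite inE sx orbT.
have /andP[Nn ne] := Ns n (mem_head _ _).
have [v [Rv nv nzv]] := sep1 Nn ne.
have [i [j nz]] := mulmx3_neq0 nzu nzv; have [Rx rx] := scP (delta_mx i j).
exists (u *m sc (delta_mx i j) *m v); split; first by rewrite !envelop_mxM.
  by rewrite !gring_opM // rx.
move=> n1; rewrite inE => /predU1P[->|sn1]; first by rewrite !opnM ?envelop_mxM // nv mulmx0.
have /andP[Nn1 _] : n1 \in [pred n in N | chi n != chi 1%g] by rewrite Ns // inE sn1 orbT.
by rewrite !opnM ?envelop_mxM // su // !mul0mx.
Qed.

Let sep M : exists u, [/\ (u \in R_H)%MS, gring_op rW u = M &
  forall n, n \in N -> chi n != chi 1%g -> opn n u = 0].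
Proof.
have [sc scP] := gring_op_section absW.
have Rs A : (sc A \in R_H)%MS by case: (scP A).
have rs A : gring_op rW (sc A) = A by case: (scP A).
have [|u [Ru nzu su]] := @sep_seq (enum [pred n in N | chi n != chi 1%g]).
  by move=> n; rewrite mem_enum.
case/matrix0Pn: (nzu) => i [j nz_ij]; set A := gring_op rW u in nzu nz_ij.
(* The image of u generates the full matrix algebra as an ideal: M is the sum over a of E_ai A
   (A_ij^-1 E_ja M). *)
exists (\sum_a sc (delta_mx a i) *m u *m sc ((A i j)^-1 *: (delta_mx j a *m M))); split.
- by rewrite linear_sum summx_sub // => a _; rewrite !envelop_mxM.
- rewrite linear_sum /= -[RHS]mul1mx mx1_sum_delta mulmx_suml.
  apply: eq_bigr => a _; rewrite !gring_opM // !rs -scalemxAr mulmxA -/A.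
  rewrite -(mul_delta_mx (0 : 'I_1) a i) -(mulmxA _ _ A) -rowE.
  rewrite -(mul_delta_mx (0 : 'I_1) j a) !mulmxA -(mulmxA (delta_mx a 0)) -colE.
  rewrite [col j _]mx11_scalar; have -> : col j (row i A) 0 0 = A i j by rewrite mxE mxE.
  rewrite mul_mx_scalar -!scalemxAl scalerA mulVf // scale1r.
  by rewrite mul_delta_mx.
move=> n Nn ne; rewrite /opn; under eq_bigr do rewrite gring_coef_sum scaler_suml.
rewrite exchange_big big1 //= => a _; rewrite -/(opn n _) !opnM ?envelop_mxM //.
by rewrite su ?mulmx0 ?mul0mx // mem_enum inE Nn.
Qed.

Let csumEr (f : gT -> k) g : g \in H -> left_invariant Z H f ->
  csum (fun h => f h *: E h) *m E g = csum (fun h => f (h * g^-1)%g *: E h).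
Proof.
move=> Hg fZ; have EZ : left_invariant Z H (fun h => f (h * g^-1)%g *: E h).
  move=> z h Zz Hh; have Hz := subsetP sZH z Zz.
  have Hhg : (h * g^-1)%g \in H by rewrite groupM ?groupV.
  by rewrite -mulgA fZ // (repr_mxM E Hz Hh) (E_Z Zz) mul1mx.
rewrite -(coset_sumMr sZH EZ Hg) /coset_sum mulmx_suml; apply: eq_bigr => X HX.
have Hx := repr_rcosets_mem HX sZH.
by rewrite mulgK repr_mxM // scalemxAl.
Qed.

(* An element of kH acting as delta_mx j i on W and as 0 on the conjugates of *)
(* W not isomorphic to it turns theta into the coefficient (i, j) of W.       *)
Let theta_sum_neq0 phi :
    csum (fun h => E (h^-1)%g *m phi *m E h) = 1%:M ->
  csum (fun h => theta h *: E h) != 0.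
Proof.
move=> phi1; have [i [j]] := coef_neq0 phi1; apply: contraNneq => zz0.
have [u [Ru ru su]] := sep (delta_mx j i).
have: csum (fun h => theta h *: E h) *m gring_op E u = 0 by rewrite zz0 mul0mx.
rewrite gring_op_coef // mulmx_sumr.
under eq_bigr => g Hg do rewrite -scalemxAr (csumEr Hg thetaZ) scaler_sumr.
rewrite exchange_big => sum0; apply/eqP; rewrite -[RHS]sum0; apply: eq_bigr => X HX.
have Hx := repr_rcosets_mem HX sZH; set h := repr X in Hx *.
under [RHS]eq_bigr do rewrite scalerA; rewrite -scaler_suml; congr (_ *: _).
have chi1_orb : chi 1%g \in orb by apply/mem_orb; exists 1%g.
rewrite /theta; under [RHS]eq_bigr do rewrite mulr_sumr; rewrite exchange_big /=.
have opnS n : n \in N -> \sum_(g in H) gring_coef u g * chi n ((h * g^-1)^-1)%g =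
    \tr (opn n u *m rW ((h^-1) ^ n^-1)%g).
  move=> Nn; rewrite mulmx_suml linear_sum; apply: eq_bigr => g Hg /=.
  rewrite -scalemxAl linearZ /= ffunE invMg invgK groupM ?groupV // conjMg.
  by rewrite repr_mxM ?memHJ ?groupV.
rewrite (bigD1_seq (chi 1%g)) ?undup_uniq //= opnS // opn1 // ru invg1 conjg1.
rewrite big1_seq ?addr0 => [|x /andP[ne /mem_orb[n Nn def_x]]]; last first.
  by rewrite def_x opnS // su ?mul0mx ?mxtrace0 // -def_x.
rewrite -(mul_delta_mx (0 : 'I_1)) -mulmxA -rowE mxtrace_mulC.
by rewrite -colE /mxtrace big_ord1 mxE mxE.
Qed.

(** Projectivity does not descend to submodules in general. Here the theta-sum is a scalar on E,
    nonzero by [theta_sum_neq0], hence nonzero on W too. So some conjugate of W contributes a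
    nonzero sum on W, which produces an isomorphism T from that conjugate onto W having the form of
    a trace; T^-1 T = 1 then exhibits the identity of W as a trace. *)
Lemma constituent_projective phi :
    csum (fun h => E (h^-1)%g *m phi *m E h) = 1%:M ->
    (forall th : gT -> k,
       (forall h n, h \in H -> n \in N -> th (h ^ n)%g = th h) ->
       left_invariant Z H th -> is_scalar_mx (csum (fun h => th h *: E h))) ->
  exists theta0, csum (fun h => rW (h^-1)%g *m theta0 *m rW h) = 1%:M.
Proof.
move=> phi1 scal; have /is_scalar_mxP[zeta def_zeta] := scal theta theta_conj thetaZ.
have := theta_sum_neq0 phi1; rewrite def_zeta => nz_zeta.
have nz_iW : iW != 0.
  have /mx_irrP[d_gt0 _] := irrW.
  by rewrite -mxrank_eq0 (eqP freeW) -lt0n.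
have nzD : csum (fun h => theta h *: rW h) != 0.
  have: csum (fun h => theta h *: rW h) *m iW = zeta *: iW.
    rewrite -mul_mx_scalar -def_zeta /coset_sum mulmx_suml mulmx_sumr.
    apply: eq_bigr => X HX; have Hx := repr_rcosets_mem HX sZH.
    by rewrite -scalemxAl homW // scalemxAr.
  move=> eqD; apply: contraNneq nz_zeta => D0; move/eqP: eqD.
  rewrite D0 mul0mx eq_sym scaler_eq0 (negPf nz_iW) orbF => /eqP->.
  by rewrite -scalemx1 scale0r.
have /hasP[x /mem_orb[n Nn ->] nz_x] :
    has (fun x : {ffun gT -> k} => csum (fun h => x (h^-1)%g *: rW h) != 0) orb.
  apply: contraNT nzD => /hasPn all0; rewrite /theta /coset_sum.
  under eq_bigr do rewrite scaler_suml.
  rewrite exchange_big big1_seq //= => x orbx; apply/eqP.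
  by have := all0 x orbx; rewrite negbK.
have Nn' := groupVr Nn; have Hr X (HX : X \in rcosets Z H) : repr X \in H := repr_rcosets_mem HX sZH.
pose f h := rW (h ^ n^-1)%g.
have fM : {in H &, {morph f : g h / (g * h)%g >-> g *m h}}.
  by move=> g h Hg Hh; rewrite /f conjMg repr_mxM ?memHJ.
have /existsP[a nz_a] : [exists a, csum (fun h => f (h^-1)%g a a *: rW h) != 0].
  apply: contraNT nz_x; rewrite negb_exists => /forallP all0; apply/eqP.
  transitivity (\sum_a csum (fun h => f (h^-1)%g a a *: rW h)); last first.
    by rewrite big1 // => a _; apply/eqP; have := all0 a; rewrite negbK.
  rewrite /coset_sum exchange_big; apply: eq_bigr => X HX /=.
  by rewrite -scaler_suml ffunE groupV Hr.
have [b [c nz_bc]] := matrix0Pn _ nz_a.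
pose F h := f (h^-1)%g *m delta_mx a b *m rW h.
have FZ : left_invariant Z H F.
  move=> z h Zz Hh; have Hz := subsetP sZH z Zz.
  rewrite /F invMg fM ?groupV // repr_mxM // [f z^-1%g]rW_conjZ ?groupV //.
  by rewrite rW_Z // mulmx1 mul1mx.
pose T := csum F.
have nzT : T != 0.
  apply/matrix0Pn; exists a, c; move: nz_bc; rewrite /T /coset_sum !summxE.
  rewrite (eq_bigr (fun X => F (repr X) a c)) // => X _.
  rewrite mxE /F -(mul_delta_mx (0 : 'I_1)) mulmxA -colE -mulmxA -rowE.
  by rewrite mxE big_ord1 !mxE.
have fT : {in H, forall g, f g *m T = T *m rW g}.
  move=> g Hg; rewrite /T -[in LHS](coset_sumMr sZH FZ Hg) /coset_sum mulmx_suml mulmx_sumr.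
  apply: eq_bigr => X /Hr Hx; rewrite /F invMg fM ?groupV // !mulmxA -fM ?groupV //.
  by rewrite mulgV /f conj1g repr_mx1 mul1mx repr_mxM // !mulmxA.
have Tu := intertwiner_unit irrW nzT fT.
(* Since rW(h^-1) T^-1 = T^-1 f(h^-1), the trace of T^-1 E_ab is T^-1 T. *)
exists (invmx T *m delta_mx a b).
rewrite -[RHS](mulVmx Tu) [in RHS]/T /coset_sum mulmx_sumr; apply: eq_bigr => X /Hr Hx.
have Hx' := groupVr Hx; rewrite /F !mulmxA; congr (_ *m _ *m _).
by apply: (canLR (mulmxK Tu)); rewrite -mulmxA fT // mulKmx.
Qed.

End Constituent.

Lemma exists_projective_constituent phi :
    (0 < m)%N ->
    coset_sum Z H (fun h => E (h^-1)%g *m phi *m E h) = 1%:M ->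
    (forall th : gT -> k,
       (forall h n, h \in H -> n \in N -> th (h ^ n)%g = th h) ->
       left_invariant Z H th ->
       is_scalar_mx (coset_sum Z H (fun h => th h *: E h))) ->
  exists d (rW : mx_representation k H d) (iW : 'M[k]_(d, m)) theta0,
    [/\ mx_absolutely_irreducible rW, row_free iW,
        {in H, forall h, rW h *m iW = iW *m E h}
      & coset_sum Z H (fun h => rW (h^-1)%g *m theta0 *m rW h) = 1%:M].
Proof.
move=> m_gt0 phi1 scal.
have nz1 : 1%:M != 0 :> 'M[k]_m by rewrite -mxrank_eq0 mxrank1 -lt0n.
have [M simM _] := dec_mxsimple_exists (mxmodule1 E) nz1.
have modM := mxsimple_module simM.
pose rW := submod_repr modM; pose iW : 'M_(\rank M, m) := val_submod 1%:M.
have absW : mx_absolutely_irreducible rW.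
  by apply: group_closure_closed_field; apply/submod_mx_irr.
have freeW : row_free iW by rewrite /row_free val_submod1.
have homW : {in H, forall h, rW h *m iW = iW *m E h}.
  by move=> h Hh; rewrite -val_submodJ // mul1mx -val_submodE.
have [theta0 th1] := constituent_projective absW freeW homW phi1 scal.
by exists (\rank M), rW, iW, theta0; split.
Qed.

End ProjectiveConstituent.

(** * Higman's criterion and vertices *)

Section ConjugationAction.

Variables (k : fieldType) (gT : finGroupType) (G : {group gT}).
Variables (n : nat) (rS : mx_representation k G n).
Implicit Types (H K L : {group gT}) (a b : 'M[k]_n).

Definition mx_conj a x := rS (x^-1)%g *m a *m rS x.

(** For H inside G these are the kH-endomorphisms of S, and [mx_trace] is Higman's relative trace
    between their algebras. *)
Definition mx_fixed H a := forall h, h \in H -> mx_conj a h = a.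

Definition mx_trace H K a := coset_sum H K (mx_conj a).

Lemma mx_conjM a b x : x \in G -> mx_conj (a *m b) x = mx_conj a x *m mx_conj b x.
Proof. by move=> Gx; rewrite /mx_conj !mulmxA (repr_mxK rS Gx). Qed.

Lemma mx_conj_comp a x y :
  x \in G -> y \in G -> mx_conj (mx_conj a x) y = mx_conj a (x * y)%g.
Proof. by move=> Gx Gy; rewrite /mx_conj invMg !repr_mxM ?groupV // !mulmxA. Qed.

Lemma mx_conj1 x : x \in G -> mx_conj 1%:M x = 1%:M.
Proof. by move=> Gx; rewrite /mx_conj mulmx1 -repr_mxM ?groupV // mulVg repr_mx1. Qed.

Lemma mx_conj_is_linear x : linear (mx_conj^~ x).
Proof.
by move=> c a b; rewrite /mx_conj mulmxDr mulmxDl -scalemxAr -scalemxAl.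
Qed.

Lemma mx_conj_sum (I : Type) (r : seq I) (P : pred I) F x :
  mx_conj (\sum_(i <- r | P i) F i) x = \sum_(i <- r | P i) mx_conj (F i) x.
Proof. by rewrite /mx_conj mulmx_sumr mulmx_suml. Qed.

Lemma mx_conj_repr x y : x \in G -> y \in G -> mx_conj (rS y) x = rS (y ^ x)%g.
Proof. by move=> Gx Gy; rewrite /mx_conj -!repr_mxM ?groupM ?groupV // conjgE mulgA. Qed.

Lemma mx_fixed_invariant H K a :
  H \subset K -> K \subset G -> mx_fixed H a -> left_invariant H K (mx_conj a).
Proof.
move=> sHK sKG fHa h x Hh Kx; have Gx := subsetP sKG x Kx.
have Gh := subsetP (subset_trans sHK sKG) h Hh.
by rewrite -mx_conj_comp // fHa.
Qed.

Lemma mx_fixed_trace H K a :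
  H \subset K -> K \subset G -> mx_fixed H a -> mx_fixed K (mx_trace H K a).
Proof.
move=> sHK sKG fHa x Kx; rewrite /mx_trace.
rewrite -[RHS](coset_sumMr sHK (mx_fixed_invariant sHK sKG fHa) Kx) /coset_sum.
rewrite mx_conj_sum; apply: eq_bigr => X HX; rewrite mx_conj_comp ?(subsetP sKG) //.
exact: repr_rcosets_mem HX sHK.
Qed.

Lemma mx_trace_trans H K L a :
    H \subset K -> K \subset L -> L \subset G -> mx_fixed H a ->
  mx_trace H L a = mx_trace K L (mx_trace H K a).
Proof.
move=> sHK sKL sLG fHa; have sHL := subset_trans sHK sKL.
rewrite /mx_trace (coset_sum_trans sHK sKL (mx_fixed_invariant sHL sLG fHa)).
apply: eq_bigr => Y KY; have Gy := subsetP sLG _ (repr_rcosets_mem KY sKL).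
rewrite mx_conj_sum; apply: eq_bigr => X HX; rewrite mx_conj_comp //.
by rewrite (subsetP sLG) // (subsetP sKL) // (repr_rcosets_mem HX).
Qed.

Lemma mx_trace_mul H K a b c :
    H \subset K -> K \subset G -> mx_fixed K b -> mx_fixed K c ->
  mx_trace H K (b *m a *m c) = b *m mx_trace H K a *m c.
Proof.
move=> sHK sKG fb fc; rewrite /mx_trace /coset_sum mulmx_sumr mulmx_suml.
apply: eq_bigr => X HX; have Kx := repr_rcosets_mem HX sHK.
by rewrite !mx_conjM ?(subsetP sKG) // fb // fc.
Qed.

(** Averaging the kH-splitting s into the sum of the x^-1 a s x makes it kG-linear; composed with f
    it becomes the trace of a. *)
Lemma Higman_rel_projective H a :
    H \subset G -> mx_fixed H a -> mx_trace H G a = 1%:M -> rel_projective H rS.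
Proof.
move=> sHG fHa tr_a m rN f homf [s homs sf1].
pose F x := rS (x^-1)%g *m a *m s *m rN x.
have FH : left_invariant H G F.
  move=> h x Hh Gx; have Gh := subsetP sHG h Hh; have Hh' := groupVr Hh.
  have := fHa h Hh; rewrite /F invMg repr_mxM ?groupV // (repr_mxM rN Gh Gx) => {2}<-.
  by rewrite /mx_conj -!mulmxA (mulmxA (rS h)) homs // -!mulmxA.
exists (coset_sum H G F).
  move=> g Gg; rewrite -[in LHS](coset_sumMr sHG FH Gg) /coset_sum mulmx_suml mulmx_sumr.
  apply: eq_bigr => X HX; have Gx := repr_rcosets_mem HX sHG.
  rewrite /F invMg (repr_mxM rS (groupVr Gg) (groupVr Gx)) (repr_mxM rN Gx Gg) !mulmxA.
  by rewrite -repr_mxM ?groupV // mulgV repr_mx1 mul1mx.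
rewrite -tr_a /mx_trace /coset_sum mulmx_suml; apply: eq_bigr => X HX.
have Gx := repr_rcosets_mem HX sHG.
by rewrite /F /mx_conj -!mulmxA homf // (mulmxA s) sf1 mul1mx.
Qed.

End ConjugationAction.

Section Higman.

Variables (k : fieldType) (gT : finGroupType) (G R : {group gT}).
Variables (n : nat) (rS : mx_representation k G n).
Hypothesis sRG : R \subset G.

Let c := #|rcosets R G|.

Let mxP (g : gT) : 'M[k]_c := @set_map_mx k _ (rcosets R G) (fun X => X :* g).

Let memRG X g : X \in rcosets R G -> g \in G -> X :* g \in rcosets R G.
Proof.
by case/rcosetsP=> x Gx -> Gg; rewrite -rcosetM -rcosetE imset_f ?groupM.
Qed.

Let mxPM g h : g \in G -> mxP (g * h)%g = mxP g *m mxP h.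
Proof.
move=> Gg; rewrite set_map_mxM => [|X HX]; last exact: memRG.
by apply: eq_set_map_mx => X _ /=; rewrite rcosetM.
Qed.

Let mxP1 : mxP 1%g = 1%:M.
Proof. by apply: set_map_mx1 => X _; rewrite rcoset1. Qed.

(** The diagonal action on the tensor product of k[R \ G] and S, whose elements are c by n matrices
    with rows indexed by cosets; this is a model of the module induced from the restriction of S to
    R. *)
Let ind_mx (g : gT) : 'M[k]_(c * n) :=
  lin1_mx (mxvec \o (mulmxr (rS g) \o mulmx (mxP g^-1%g)) \o vec_mx).

Let ind_mxE g (v : 'M_(c, n)) : mxvec v *m ind_mx g = mxvec (mxP g^-1%g *m v *m rS g).
Proof. by rewrite mul_rV_lin1 /= mxvecK. Qed.

Let ind_mx_repr : mx_repr G ind_mx.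
Proof.
split=> [|g h Gg Gh]; apply/row_matrixP=> i; rewrite !rowE -[delta_mx 0 i]vec_mxK.
  by rewrite ind_mxE invg1 mxP1 mul1mx repr_mx1 !mulmx1.
by rewrite mulmxA !ind_mxE invMg mxPM ?groupV // repr_mxM // !mulmxA.
Qed.

(** Relative projectivity is applied to the sum of the rows, a map onto S which splits over R by
    placing a vector in the row of the trivial coset. For a kG-splitting, let a be its component at
    the trivial coset: the component at R x is then the x-conjugate of a, and the components add up
    to 1. *)
Lemma Higman_trace :
  rel_projective R rS -> exists2 a, mx_fixed rS R a & mx_trace rS R G a = 1%:M.
Proof.
pose rN := MxRepresentation ind_mx_repr.
pose f : 'M[k]_(c * n, n) := lin1_mx (mulmx (const_mx 1 : 'rV_c) \o vec_mx).
have fE (v : 'M_(c, n)) : mxvec v *m f = const_mx 1 *m v.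
  by rewrite mul_rV_lin1 /= mxvecK.
have R1 : gval R \in rcosets R G by apply/rcosetsP; exists 1%g; rewrite ?rcoset1.
pose ix x := enum_rank_in R1 (R :* x).
have ixP x : x \in G -> enum_val (ix x) = R :* x.
  by move=> Gx; rewrite enum_rankK_in // -rcosetE imset_f.
have mxPE x g (v : 'M_(c, n)) : x \in G -> g \in G ->
    row (ix x) (mxP g^-1 *m v) = row (ix (x * g^-1)%g) v.
  move=> Gx Gg; rewrite row_mul [in RHS]rowE; congr (_ *m _); apply/rowP=> j.
  rewrite !mxE ixP // -rcosetM -ixP ?groupM ?groupV // (inj_eq enum_val_inj).
  by rewrite eqxx eq_sym.
have homf : repr_hom G rN rS f.
  move=> g Gg; apply/row_matrixP=> i; rewrite !rowE -[delta_mx 0 i]vec_mxK.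
  rewrite !mulmxA ind_mxE !fE !mulmxA; congr (_ *m _ *m _).
  apply/rowP=> j; rewrite !mxE; under eq_bigr do rewrite !mxE mul1r.
  rewrite -(big_enum_val (fun X => (X :* g^-1 == enum_val j)%:R)).
  rewrite (bigD1 (enum_val j :* g)) ?memRG ?enum_valP //=.
  rewrite -rcosetM mulgV rcoset1 eqxx big1 ?addr0 // => X /andP[_ ne].
  rewrite (_ : (_ == _) = false) //; apply: contraNF ne => /eqP <-.
  by rewrite -rcosetM mulVg rcoset1.
move=> projR; have [] := projR _ rN f homf.
  pose s0 : 'M[k]_(n, c * n) := lin1_mx (mxvec \o mulmx (delta_mx (ix 1%g) 0 : 'cV_c)).
  have s0E w : w *m s0 = mxvec (delta_mx (ix 1%g) 0 *m w) by rewrite mul_rV_lin1.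
  exists s0.
    move=> g Rg; apply/row_matrixP=> i; rewrite !rowE !mulmxA !s0E ind_mxE !mulmxA; congr (mxvec (_ *m _ *m _)).
    rewrite -colE; apply/colP=> j; rewrite !mxE eqxx andbT ixP // rcoset1.
    rewrite -(inj_eq enum_val_inj) ixP // rcoset1; congr (nat_of_bool _)%:R.
    apply/eqP/eqP=> [->|eqR]; first by rewrite rcoset_id ?groupV.
    have: enum_val j :* g^-1 :* g = R :* g by rewrite eqR.
    by rewrite -rcosetM mulVg rcoset1 rcoset_id.
  apply/row_matrixP=> i; rewrite !rowE mulmxA s0E fE mulmxA.
  by rewrite -colE col_const (_ : const_mx 1 = 1%:M) ?mul1mx ?mulmx1 //; apply/matrixP=> a b; rewrite !ord1 !mxE.
move=> s homs sf1.
pose a : 'M_n := lin1_mx (row (ix 1%g) \o (vec_mx \o mulmxr s)).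
have aE w : w *m a = row (ix 1%g) (vec_mx (w *m s)) by rewrite mul_rV_lin1.
have keyE x w : x \in G -> row (ix x) (vec_mx (w *m s)) = w *m mx_conj rS a x.
  move=> Gx; have -> : w *m s = w *m rS x^-1%g *m s *m rN x.
    by rewrite -(mulmxA _ s) -homs // !mulmxA (repr_mxKV rS Gx).
  rewrite -[w *m _ *m s]vec_mxK ind_mxE mxvecK row_mul mxPE // mulgV -aE.
  by rewrite /mx_conj !mulmxA.
exists a.
  move=> x Rx; have Gx := subsetP sRG x Rx; apply/row_matrixP=> i.
  rewrite !rowE -keyE // aE /ix rcoset1; congr (row (enum_rank_in _ _) _).
  exact: rcoset_id.
apply/row_matrixP=> i; rewrite !rowE mulmx1 /mx_trace /coset_sum mulmx_sumr.
have /(congr1 (mulmx (delta_mx 0 i : 'rV_n))) := sf1.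
rewrite mulmx1 mulmxA -[_ *m s]vec_mxK fE mulmx_sum_row => sum_i.
rewrite -[RHS]sum_i (big_enum_rank R1); apply: eq_bigr => X HX.
have Gx := repr_rcosets_mem HX sRG; rewrite mxE scale1r -keyE //.
congr (row (enum_rank_in _ _) _).
by case/rcosetsP: HX => x _ ->; rewrite rcoset_repr.
Qed.

End Higman.

Lemma orbit_sum (gT : finGroupType) (sT : finType) (D P : {group gT})
    (to : action D sT) (V : nmodType) (x : sT) (v : sT -> V) :
    P \subset D ->
  \sum_(y in orbit to P x) v y = coset_sum 'C_P[x | to] P (fun a => v (to x a)).
Proof.
move=> sPD; rewrite orbit_stabilizer // big_imset //=.
exact: can_in_inj (act_reprK sPD).
Qed.

Section VertexIdeal.

Variables (k : closedFieldType) (gT : finGroupType) (G R : {group gT}).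
Variables (n : nat) (rS : mx_representation k G n).
Hypotheses (irrS : mx_irreducible rS) (vertexR : is_vertex rS R).

Local Notation conj := (mx_conj rS).
Local Notation fixedR := (mx_fixed rS R).
Local Notation Tr := (mx_trace rS).

Let sRG : R \subset G. Proof. by case: vertexR. Qed.

Let memRG x : x \in R -> x \in G. Proof. exact: subsetP. Qed.

Lemma fixed_scalar a : mx_fixed rS G a -> is_scalar_mx a.
Proof.
move=> fa; have absS := @group_closure_closed_field k gT G n rS irrS.
apply: (mx_abs_irr_cent_scalar absS); apply/centgmxP=> x Gx.
by rewrite -{2}(fa x Gx) /mx_conj !mulmxA -repr_mxM ?groupV // mulgV repr_mx1 mul1mx.
Qed.

(** The trace is a scalar by Schur; if it were nonzero, Higman's criterion would make S projective
    relative to H, against the minimality of R. *)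
Lemma vertex_trace0 (H : {group gT}) a :
  H \proper R -> mx_fixed rS H a -> Tr H G a = 0.
Proof.
move=> ltHR fa; have sHR := proper_sub ltHR; have sHG := subset_trans sHR sRG.
have /fixed_scalar/is_scalar_mxP[c def_c] := mx_fixed_trace sHG (subxx G) fa.
have [c0|nzc] := eqVneq c 0; first by rewrite def_c c0 -scalemx1 scale0r.
have [_ _ minR] := vertexR.
suffices /(minR H sHR) defH : rel_projective H rS.
  by move: ltHR; rewrite defH properxx.
apply: (Higman_rel_projective (a := c^-1 *: a)) => //.
  by move=> h Hh; rewrite /mx_conj -scalemxAr -scalemxAl -/(conj a h) fa.
have -> : Tr H G (c^-1 *: a) = c^-1 *: Tr H G a.
  rewrite /mx_trace /coset_sum scaler_sumr; apply: eq_bigr => X _.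
  by rewrite /mx_conj -scalemxAr -scalemxAl.
by rewrite def_c scale_scalar_mx mulVf.
Qed.

(* The largest ideal of End_R(S) contained in the kernel of the trace to G.   *)
Definition vertex_ideal a :=
  fixedR a /\ forall c d, fixedR c -> fixedR d -> Tr R G (c *m a *m d) = 0.

Lemma fixedR_mul a b : fixedR a -> fixedR b -> fixedR (a *m b).
Proof. by move=> fa fb x Rx; rewrite mx_conjM ?memRG // fa // fb. Qed.

Lemma fixedR1 : fixedR 1%:M.
Proof. by move=> x Rx; rewrite mx_conj1 ?memRG. Qed.

Lemma fixedR_lin c a b : fixedR a -> fixedR b -> fixedR (c *: a + b).
Proof. by move=> fa fb x Rx; rewrite mx_conj_is_linear fa // fb. Qed.

Lemma fixedR0 : fixedR 0.
Proof. by move=> x Rx; rewrite /mx_conj mulmx0 mul0mx. Qed.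

Lemma fixedR_repr h : h \in 'C_G(R) -> fixedR (rS h).
Proof.
case/setIP=> Gh cRh x Rx; have Gx := memRG Rx.
have hx : (h ^ x)%g = h by apply/conjg_fixP/commgP; apply: (centP cRh).
by rewrite mx_conj_repr // hx.
Qed.

Lemma mx_trace_lin H K c a b : Tr H K (c *: a + b) = c *: Tr H K a + Tr H K b.
Proof.
rewrite /mx_trace /coset_sum scaler_sumr -big_split; apply: eq_bigr => X _ /=.
exact: mx_conj_is_linear.
Qed.

Lemma vertex_ideal0 : vertex_ideal 0.
Proof.
split=> [|c d _ _]; first exact: fixedR0.
rewrite mulmx0 mul0mx /mx_trace /coset_sum big1 // => X _.
by rewrite /mx_conj mulmx0 mul0mx.
Qed.

Lemma vertex_ideal_lin c a b :
  vertex_ideal a -> vertex_ideal b -> vertex_ideal (c *: a + b).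
Proof.
move=> [fa Ka] [fb Kb]; split=> [|u v fu fv]; first exact: fixedR_lin.
rewrite mulmxDr mulmxDl -scalemxAr -scalemxAl mx_trace_lin Ka // Kb //.
by rewrite scaler0 addr0.
Qed.

Lemma vertex_ideal_sum (I : Type) (r : seq I) (P : pred I) F :
  (forall i, P i -> vertex_ideal (F i)) -> vertex_ideal (\sum_(i <- r | P i) F i).
Proof.
move=> KF; apply: big_ind => //; first exact: vertex_ideal0.
by move=> a b Ka Kb; rewrite -[a]scale1r; apply: vertex_ideal_lin.
Qed.

Lemma vertex_idealMl a b : fixedR a -> vertex_ideal b -> vertex_ideal (a *m b).
Proof.
move=> fa [fb Kb]; split=> [|c d fc fd]; first exact: fixedR_mul.
by rewrite mulmxA Kb //; apply: fixedR_mul.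
Qed.

Lemma vertex_idealMr a b : fixedR a -> vertex_ideal b -> vertex_ideal (b *m a).
Proof.
move=> fa [fb Kb]; split=> [|c d fc fd]; first exact: fixedR_mul.
by rewrite mulmxA -(mulmxA _ a) Kb //; apply: fixedR_mul.
Qed.

Lemma vertex_ideal_trace (H : {group gT}) a :
  H \proper R -> mx_fixed rS H a -> vertex_ideal (Tr H R a).
Proof.
move=> ltHR fa; have sHR := proper_sub ltHR; split=> [|c d fc fd].
  exact: mx_fixed_trace.
have fcad : mx_fixed rS H (c *m a *m d).
  move=> h Hh; have Rh := subsetP sHR h Hh.
  by rewrite !mx_conjM ?memRG // fa // fc // fd.
by rewrite -mx_trace_mul // -mx_trace_trans // vertex_trace0.
Qed.

(** The counterpart of [pgroup_sum_fix] modulo the ideal: a nontrivial orbit of R sums to a trace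
    from a point stabilizer, a proper subgroup of R. *)
Lemma vertex_ideal_nonfixed (sT : finType) (D : {group gT}) (to : action D sT)
    (S : {set sT}) (v : sT -> 'M[k]_n) :
    [acts R, on S | to] ->
    (forall x a, x \in S -> a \in R -> v (to x a) = conj (v x) a) ->
  vertex_ideal (\sum_(x in S) v x - \sum_(x in 'Fix_(S | to)(R)) v x).
Proof.
move=> nSR vR; have sRD := acts_dom nSR.
rewrite (big_setID 'Fix_to(R)) /= addrAC subrr add0r.
have nS'R: [acts R, on S :\: 'Fix_to(R) | to].
  rewrite actsD // -(setIidPr sRD); apply: subset_trans (acts_subnorm_fix _ _).
  by rewrite setIS ?normG.
rewrite -/(\sum_(x in S :\: 'Fix_to(R)) v x).
rewrite (partition_big_imset (orbit to R)) /=.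
apply: vertex_ideal_sum => O /imsetP[x S'x ->{O}]; have /setDP[Sx nfx] := S'x.
rewrite (eq_bigl (mem (orbit to R x))) => [|y]; last first.
  apply/andP/idP=> [[_ /eqP <-] | xRy]; first exact: orbit_refl.
  by rewrite (subsetP _ y xRy) ?acts_sub_orbit //; split=> //; apply/eqP/orbit_in_eqP.
rewrite (orbit_sum _ _ _ sRD).
have sCR : 'C_R[x | to] \subset R by exact: subsetIl.
rewrite (_ : coset_sum _ _ _ = Tr 'C_R[x | to]%G R (v x)).
  apply: vertex_ideal_trace => [|h /setIP[Rh /astab_act/(_ (set11 x)) cxh]].
    rewrite properEneq sCR andbT; apply: contra nfx => /eqP eqCR.
    apply/afixP=> a Ra; have: a \in 'C_R[x | to] by rewrite eqCR.
    by case/setIP=> _ /astab_act; apply; apply: set11.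
  by rewrite -vR // cxh.
by apply: eq_coset_sum => // a Ra; rewrite vR.
Qed.

End VertexIdeal.

(** The vertex ideal is defined by a quantification over matrices, so a matrix for it is obtained
    only classically, by enlarging a subspace inside P as long as possible. That is enough, because
    the goal it serves is a boolean inclusion of groups. *)
Lemma subspace_mx (k : fieldType) m (P : 'rV[k]_m -> Prop) :
    P 0 -> (forall c u v, P u -> P v -> P (c *: u + v)) ->
  classically (exists U : 'M[k]_m, forall v, (v <= U)%MS <-> P v).
Proof.
move=> P0 Plin b Ub.
suffices: forall d (U : 'M[k]_m), (m - \rank U < d)%N ->
    (forall v, (v <= U)%MS -> P v) -> b.
  move/(_ (m - \rank (0 : 'M[k]_m)).+1 0 (ltnSn _)); apply=> v.
  by rewrite submx0 => /eqP->.
elim=> // d IHd U ltUd PU.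
apply: (@classic_EM (exists v, P v /\ ~~ (v <= U)%MS) b).
case=> [[v [Pv nUv]] | maxU]; last first.
  apply: Ub; exists U => v; split=> [|Pv]; first exact: PU.
  by apply: contraT => nUv; case: maxU; exists v.
have ltU : (\rank U < \rank (U + v)%MS)%N.
  rewrite ltnNge; apply: contra nUv => leU.
  have /eqmxP eqU : (U == U + v)%MS by rewrite -(geq_leqif (mxrank_leqif_eq (addsmxSl U v))).
  by rewrite eqU addsmxSr.
apply: (IHd (U + v)%MS) => [|w].
  rewrite -ltnS; apply: leq_ltn_trans ltUd; apply: ltn_sub2l => //.
  exact: leq_trans ltU (rank_leq_col _).
case/sub_addsmxP=> [[u1 u2] ->] /=.
rewrite (mx11_scalar u2) mul_scalar_mx addrC; apply: Plin => //.
by apply: PU; apply: submxMl.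
Qed.

Lemma section_mx (k : fieldType) m (K X : 'M[k]_m) :
    (K <= X)%MS -> ~~ (X <= K)%MS ->
  exists r (i : 'M[k]_(r, m)) (pr : 'M[k]_(m, r)),
    [/\ (0 < r)%N, i *m pr = 1%:M, (i <= X)%MS, K *m pr = 0
      & forall x : 'rV_m, (x <= X)%MS -> (x - x *m pr *m i <= K)%MS].
Proof.
move=> sKX nsXK; pose C := (X :\: K)%MS; pose i := row_base C.
have CK0 : (C :&: K = 0)%MS by apply/eqP; rewrite -submx0 capmx_diff.
have defX : (X <= C + K)%MS.
  by rewrite -(addsmx_diff_cap_eq X K) addsmxS // capmxSr.
pose pr := proj_mx C K *m pinvmx i.
have prE (x : 'rV_m) : x *m pr *m i = x *m proj_mx C K.
  by rewrite /pr mulmxA mulmxKpV // eq_row_base proj_mx_sub.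
exists (\rank C), i, pr; split.
- rewrite lt0n mxrank_eq0; apply: contra nsXK => /eqP C0.
  by apply: submx_trans defX _; rewrite C0 addsmx_sub sub0mx /=.
- rewrite /pr mulmxA proj_mx_id ?eq_row_base //; apply: (row_free_inj (row_base_free C)).
  by rewrite -/i mulmxKpV // mul1mx.
- by rewrite eq_row_base diffmxSl.
- by rewrite /pr mulmxA proj_mx_0 ?mul0mx.
move=> x Xx; rewrite prE -{1}(add_proj_mx CK0 (submx_trans Xx defX)) addrC addKr.
exact: proj_mx_sub.
Qed.

Lemma unipotent_sub1_nilpotent (k : fieldType) (p m n : nat) (A : 'M[k]_n) :
  p \in [pchar k] -> A ^+ (p ^ m) = 1 -> (A - 1) ^+ (p ^ m) = 0.
Proof.
move=> charkp; case: n A => [|n] A A1; first by apply/matrixP=> -[].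
have charM : p \in [pchar 'M[k]_n.+1].
  rewrite inE (pcharf_prime charkp) /= -scaler_nat (pcharf0 charkp) scale0r.
  by rewrite eqxx.
have -> : (A - 1) ^+ (p ^ m) = A ^+ (p ^ m) - 1; last by rewrite A1 subrr.
elim: m {A1} => [|m IHm]; first by rewrite !expr1.
rewrite expnSr !exprM IHm -!(pFrobenius_autE charM).
rewrite pFrobenius_autB_comm; last exact: commr1.
by rewrite pFrobenius_aut1.
Qed.

(** * Knoerr's theorem *)

Section SectionAlgebra.

Variables (k : closedFieldType) (gT : finGroupType) (G R : {group gT}).
Variables (n : nat) (rS : mx_representation k G n).
Hypotheses (irrS : mx_irreducible rS) (vertexR : is_vertex rS R).

Local Notation conj := (mx_conj rS).
Local Notation fixedR := (mx_fixed rS R).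
Local Notation idealR := (vertex_ideal R rS).
Local Notation Tr := (mx_trace rS).

(* Modulo the vertex ideal, these a are the fixed points of 'Z(R). Below, K   *)
(* and X encode the ideal and the fixed points through mxvec, the rows of i   *)
(* are a basis of a complement of K in X, and sec_mx a is the matrix of right *)
(* multiplication by a on X / K.                                              *)
Definition center_fixed a :=
  fixedR a /\ forall z, z \in 'Z(R) -> idealR (a *m rS z - a).

Variables (K X : 'M[k]_(n * n)) (r : nat).
Variables (i : 'M[k]_(r, n * n)) (pr : 'M[k]_(n * n, r)).
Hypotheses (KP : forall v, (v <= K)%MS <-> idealR (vec_mx v))
  (XP : forall v, (v <= X)%MS <-> center_fixed (vec_mx v)).
Hypotheses (r_gt0 : (0 < r)%N) (i_pr : i *m pr = 1%:M) (sub_iX : (i <= X)%MS)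
  (K_pr : K *m pr = 0)
  (X_pr : forall x : 'rV_(n * n), (x <= X)%MS -> (x - x *m pr *m i <= K)%MS).

Let sRG : R \subset G. Proof. by case: vertexR. Qed.

Definition sec_mx (a : 'M[k]_n) := i *m lin_mulmxr a *m pr.

Let mul_lin (v : 'rV_(n * n)) (a : 'M[k]_n) :
  v *m lin_mulmxr a = mxvec (vec_mx v *m a).
Proof. by rewrite -[v in LHS]vec_mxK mul_vec_lin. Qed.

(** An R-endomorphism commutes with [rS z] for z in Z(R), so the condition defining X survives right
    multiplication. *)
Let XM a : fixedR a -> (X *m lin_mulmxr a <= X)%MS.
Proof.
move=> fa; apply/row_subP=> j; rewrite row_mul mul_lin; apply/XP; rewrite mxvecK.
have /XP[fx cx] := row_sub j X; split=> [|z Zz]; first exact: (fixedR_mul vertexR).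
have Rz : z \in R by case/setIP: Zz.
have ca : a *m rS z = rS z *m a.
  have Gz := subsetP sRG z Rz.
  by rewrite -{2}(fa z Rz) /mx_conj !mulmxA -repr_mxM ?groupV // mulgV repr_mx1 mul1mx.
by rewrite -mulmxA ca mulmxA -mulmxBl; apply: (vertex_idealMr vertexR) => //; apply: cx.
Qed.

Let KM a : fixedR a -> (K *m lin_mulmxr a <= K)%MS.
Proof.
move=> fa; apply/row_subP=> j; rewrite row_mul mul_lin; apply/KP; rewrite mxvecK.
by apply: (vertex_idealMr vertexR) => //; apply/KP/row_sub.
Qed.

Let sub_pr m (A : 'M_(m, n * n)) : (A <= K)%MS -> A *m pr = 0.
Proof. by case/submxP=> D ->; rewrite -mulmxA K_pr mulmx0. Qed.

Lemma sec_mxM a b : fixedR a -> fixedR b -> sec_mx (a *m b) = sec_mx a *m sec_mx b.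
Proof.
move=> fa fb; apply/eqP; rewrite -subr_eq0; apply/eqP/row_matrixP=> j; rewrite row0.
set x := row j i *m lin_mulmxr a.
have Xx : (x <= X)%MS.
  by apply: submx_trans (XM fa); rewrite submxMr // (submx_trans (row_sub _ _)).
rewrite linearB /= !row_mul -/x !mulmxA -/x.
have -> : row j i *m lin_mulmxr (a *m b) = x *m lin_mulmxr b.
  by rewrite /x !mul_lin mxvecK mulmxA.
rewrite -!mulmxBl; apply: sub_pr; apply: submx_trans (KM fb).
by rewrite submxMr // X_pr.
Qed.

Lemma sec_mx1 : sec_mx 1%:M = 1%:M.
Proof.
rewrite -i_pr /sec_mx; congr (_ *m _); apply/row_matrixP=> j.
by rewrite row_mul mul_lin mulmx1 vec_mxK.
Qed.

Lemma sec_mx_is_linear : linear sec_mx.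
Proof.
by move=> c a b; rewrite /sec_mx linearP /= mulmxDr mulmxDl -scalemxAr -scalemxAl.
Qed.

Lemma sec_mx_sum (I : Type) (s : seq I) (P : pred I) (F : I -> 'M[k]_n) :
  sec_mx (\sum_(j <- s | P j) F j) = \sum_(j <- s | P j) sec_mx (F j).
Proof.
have sec0 : sec_mx 0 = 0.
  by have := sec_mx_is_linear (-1) 0 0; rewrite scaler0 addr0 scaleN1r addNr.
apply: (big_morph sec_mx) => // a b.
by rewrite -[a]scale1r sec_mx_is_linear !scale1r.
Qed.

Lemma sec_mx_ideal a : idealR a -> sec_mx a = 0.
Proof.
move=> Ka; apply: sub_pr; apply/row_subP=> j; rewrite row_mul mul_lin.
apply/KP; rewrite mxvecK; apply: (vertex_idealMl vertexR) => //.
have /XP[] // : (row j i <= X)%MS by exact: submx_trans (row_sub _ _) sub_iX.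
Qed.

Lemma sec_mx_eq a b : idealR (a - b) -> sec_mx a = sec_mx b.
Proof.
move/sec_mx_ideal => sec0; rewrite -[a](subrK b) -[a - b]scale1r sec_mx_is_linear.
by rewrite sec0 scaler0 add0r.
Qed.

Let E h := sec_mx (rS h).

Let E_repr : mx_repr 'C_G(R) E.
Proof.
split=> [|g h Cg Ch]; first by rewrite /E repr_mx1 sec_mx1.
rewrite /E -sec_mxM; try exact: (fixedR_repr vertexR).
by case/setIP: Cg => Gg _; case/setIP: Ch => Gh _; rewrite repr_mxM.
Qed.

Let E_Z z : z \in 'Z(R) -> E z = 1%:M.
Proof.
move=> Zz; rewrite /E -i_pr /sec_mx; apply/eqP; rewrite -subr_eq0 -mulmxBl.
apply/eqP/sub_pr/row_subP=> j; rewrite linearB /= row_mul mul_lin; apply/KP.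
rewrite linearB /= mxvecK.
by have /XP[_] : (row j i <= X)%MS by [exact: submx_trans (row_sub _ _) sub_iX]; apply.
Qed.

(** R permutes its right cosets in G by right translation and fixes those inside N_G(R); the other
    orbits fall into the ideal. *)
Lemma sec_mx_trace a : fixedR a ->
  sec_mx (Tr R G a) = coset_sum R 'N_G(R) (fun x => sec_mx (conj a x)).
Proof.
move=> fa; have inv_a := mx_fixed_invariant sRG (subxx G) fa.
have nRG : [acts R, on rcosets R G | 'Rs].
  exact: subset_trans sRG (actsRs_rcosets R G).
have vR X0 x : X0 \in rcosets R G -> x \in R ->
    conj a (repr ('Rs%act X0 x)) = conj (conj a (repr X0)) x.
  move=> /rcosetsP[y Gy ->] Rx; have Gx := subsetP sRG x Rx.
  rewrite /= rcosetE -rcosetM !(left_invariant_repr inv_a) ?groupM //.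
  by rewrite mx_conj_comp.
have := vertex_ideal_nonfixed irrS vertexR nRG vR.
rewrite afixRs_rcosets => /sec_mx_eq; rewrite -/(coset_sum R G (conj a)) => ->.
by rewrite sec_mx_sum.
Qed.

Lemma fixedR_conj a x : fixedR a -> x \in 'N_G(R) -> fixedR (conj a x).
Proof.
move=> fa /setIP[Gx nRx] y Ry; have Ry' : (y ^ x^-1)%g \in R by rewrite memJ_norm ?groupV.
have Gy := subsetP sRG y Ry; have Gy' := subsetP sRG _ Ry'.
by rewrite mx_conj_comp // conjgCV -mx_conj_comp // fa.
Qed.

Let rE := MxRepresentation E_repr.

Let sZC : 'Z(R) \subset 'C_G(R).
Proof. exact: setSI. Qed.

Lemma sec_mxZ c a : sec_mx (c *: a) = c *: sec_mx a.
Proof.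
have sec0 : sec_mx 0 = 0.
  by have := sec_mx_is_linear (-1) 0 0; rewrite scaler0 addr0 scaleN1r addNr.
by have := sec_mx_is_linear c a 0; rewrite sec0 !addr0.
Qed.

(** C_G(R) permutes the cosets of R in N_G(R), and every stabilizer is the intersection of C_G(R)
    with R, that is Z(R). Grouping the sum for the identity by orbits turns it into a trace from
    Z(R); phi collects one term per orbit. *)
Lemma sec_mx_projective a : fixedR a -> Tr R G a = 1%:M ->
  exists phi, coset_sum 'Z(R) 'C_G(R)
    (fun h => rE (h^-1)%g *m phi *m rE h) = 1%:M.
Proof.
move=> fa tr_a; have := sec_mx_trace fa; rewrite tr_a sec_mx1 => sum1.
have sCN : 'C_G(R) \subset 'N_G(R) by rewrite setIS ?cent_sub.
pose S := rcosets R 'N_G(R); pose v X0 := sec_mx (conj a (repr X0)).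
have nSC : [acts 'C_G(R), on S | 'Rs] by exact: subset_trans sCN (actsRs_rcosets _ _).
pose O := orbit 'Rs%act 'C_G(R) @: S.
exists (\sum_(T in O) v (repr T)); rewrite sum1 /coset_sum.
rewrite [RHS](partition_big_imset (orbit 'Rs%act 'C_G(R))) /= -/O.
under eq_bigr do rewrite mulmx_sumr mulmx_suml; rewrite exchange_big /=.
apply: eq_bigr => T OT; have /imsetP[X1 SX1 defT] := OT.
have T_X : repr T \in T by rewrite defT; apply: mem_repr (orbit_refl _ _ _).
have SX : repr T \in S.
  by have := acts_sub_orbit X1 nSC; rewrite SX1 => /subsetP->; rewrite -?defT.
have defT' : T = orbit 'Rs%act 'C_G(R) (repr T).
  by rewrite {1}defT; apply/esym/orbit_in_eqP; rewrite ?subsetT // -defT.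
rewrite [RHS](eq_bigl (mem T)) => [|Y1]; last first.
  apply/andP/idP=> [[_ /eqP <-] | TY]; first exact: orbit_refl.
  split; last by apply/eqP; rewrite [RHS]defT'; apply/orbit_in_eqP; rewrite ?subsetT // -defT'.
  by have := acts_sub_orbit X1 nSC; rewrite SX1 => /subsetP->; rewrite -?defT.
rewrite [in RHS]defT'.
transitivity (\sum_(y in orbit 'Rs%act 'C_G(R) (repr T)) v y); last exact: eq_bigl.
rewrite [RHS](orbit_sum 'Rs%act (repr T) v (subsetT _)).
have /rcosetsP[x /setIP[Gx nRx] defX] := SX.
have defC : 'C_('C_G(R))[repr T | 'Rs] = 'Z(R).
  rewrite defX -rcosetE astab1_act astab1Rs (normP nRx).
  by rewrite setIC setIA (setIidPl sRG).
rewrite /coset_sum /= defC; apply: eq_bigr => Y ZY.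
have /setIP[Gh cRh] := repr_rcosets_mem ZY sZC; set h := repr Y in Gh cRh *.
have Ch : h \in 'C_G(R) by rewrite inE Gh.
have fX : fixedR (conj a x) by apply: fixedR_conj => //; apply/setIP.
have inv_a := mx_fixed_invariant sRG (subxx G) fa.
have Ch' : h^-1%g \in 'C_G(R) by rewrite groupV.
have fh := fixedR_repr vertexR.
rewrite /v defX rcosetE -rcosetM !(left_invariant_repr inv_a) ?groupM //.
have f1 : fixedR (rS h) := fh h Ch; have f2 : fixedR (rS h^-1%g) := fh _ Ch'.
rewrite -mx_conj_comp // -[conj (conj a x) h]/(rS h^-1%g *m conj a x *m rS h).
have f3 : fixedR (rS h^-1%g *m conj a x) by apply: (fixedR_mul vertexR).
by rewrite (sec_mxM f3 f1) (sec_mxM f2 fX).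
Qed.

(** Let b be the lift of the sum to S. The trace of a b to G is a scalar by Schur, while modulo the
    ideal it is a sum over N_G(R) of conjugates of a times conjugates of b. The latter all act as b,
    and the former add up to 1. *)
Lemma sec_mx_scalar a (th : gT -> k) : fixedR a -> Tr R G a = 1%:M ->
    (forall h m, h \in 'C_G(R) -> m \in 'N_G(R) -> th (h ^ m)%g = th h) ->
    left_invariant 'Z(R) 'C_G(R) th ->
  is_scalar_mx (coset_sum 'Z(R) 'C_G(R) (fun h => th h *: rE h)).
Proof.
move=> fa tr_a thJ thZ.
have sCG : 'C_G(R) \subset G by exact: subsetIl.
have fh := fixedR_repr vertexR.
have Hr Y : Y \in rcosets 'Z(R) 'C_G(R) -> repr Y \in 'C_G(R).
  by move=> ZY; apply: repr_rcosets_mem ZY sZC.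
pose b := coset_sum 'Z(R) 'C_G(R) (fun h => th h *: rS h).
have fb : fixedR b.
  move=> x Rx; rewrite /b /coset_sum mx_conj_sum; apply: eq_bigr => Y /Hr Ch.
  by rewrite /mx_conj -scalemxAr -scalemxAl -/(conj (rS (repr Y)) x) fh.
have sec_b : sec_mx b = coset_sum 'Z(R) 'C_G(R) (fun h => th h *: rE h).
  by rewrite sec_mx_sum; apply: eq_bigr => Y _; rewrite sec_mxZ.
have invE : left_invariant 'Z(R) 'C_G(R) (fun h => th h *: rE h).
  move=> z h Zz Ch; have Cz := subsetP sZC z Zz.
  by rewrite thZ // (repr_mxM rE Cz Ch) [rE z]E_Z // mul1mx.
have sec_bJ x : x \in 'N_G(R) -> sec_mx (conj b x) = sec_mx b.
  move=> Nx; have /setIP[Gx nRx] := Nx.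
  have nZx : x \in 'N('Z(R)) by rewrite (subsetP (char_norms (center_char R))).
  have nCx : x \in 'N('C_G(R)).
    apply: (subsetP _ x Nx); rewrite normsI ?norms_cent ?subsetIr //.
    by rewrite (subset_trans (subsetIl _ _)) ?normG.
  rewrite sec_b -(coset_sumJ sZC invE nZx nCx) /b /coset_sum mx_conj_sum sec_mx_sum.
  apply: eq_bigr => Y /Hr Ch; have Gh := subsetP sCG _ Ch.
  rewrite thJ // /mx_conj -scalemxAr -scalemxAl -/(conj (rS (repr Y)) x) sec_mxZ.
  by rewrite mx_conj_repr.
have fab : fixedR (a *m b) by apply: (fixedR_mul vertexR).
have /(fixed_scalar irrS)/is_scalar_mxP[c def_c] := mx_fixed_trace sRG (subxx G) fab.
rewrite -sec_b; apply/is_scalar_mxP; exists c.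
have <- : sec_mx c%:M = c%:M by rewrite -[in LHS]scalemx1 sec_mxZ sec_mx1 scalemx1.
rewrite -def_c sec_mx_trace // -[LHS]mul1mx -sec_mx1 -tr_a sec_mx_trace // mulmx_suml.
have sRN : R \subset 'N_G(R) by rewrite subsetI sRG normG.
apply: eq_bigr => Y NY; have Nx := repr_rcosets_mem NY sRN.
have /setIP[Gx _] := Nx.
by rewrite -(sec_bJ _ Nx) mx_conjM // [RHS]sec_mxM //; apply: fixedR_conj.
Qed.

(** Under conjugation by R, the part of b outside C_G(R) splits into nontrivial orbits and so acts
    through the ideal. *)
Lemma sec_mx_Brauer (b : 'M[k]_#|G|) :
    (b \in 'Z(group_ring k G))%MS ->
  gring_op rE (Brauer_map R b) = sec_mx (gring_op rS b).
Proof.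
case/gring_center_coefP=> Rb clb; rewrite !gring_op_coef ?Brauer_map_mem //.
pose v x := gring_coef b x *: rS x.
have nGR : [acts R, on G | 'J] by rewrite astabsJ (subset_trans sRG) ?normG.
have vR x y : x \in G -> y \in R -> v ('J%act x y) = conj (v x) y.
  move=> Gx Ry; have Gy := subsetP sRG y Ry.
  rewrite /v /= clb // /mx_conj -scalemxAr -scalemxAl -/(conj (rS x) y).
  by rewrite mx_conj_repr.
have := vertex_ideal_nonfixed irrS vertexR nGR vR.
rewrite afixJ => /sec_mx_eq ->; rewrite sec_mx_sum; apply: eq_bigr => x Cx.
by rewrite sec_mxZ Brauer_map_coef.
Qed.

(** Both e = Br_R(b) and the trace y of a lift of [theta0] act as the identity on the constituent W,
    so y e is not nilpotent. By locality e = y v with v central, again a trace from Z(R). *)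
Lemma block_rel_trace_center (b : 'M[k]_#|G|) a :
    (b \in 'Z(group_ring k G))%MS -> gring_op rS b = 1%:M ->
    is_block (Brauer_map R b) -> fixedR a -> Tr R G a = 1%:M ->
  exists2 A, (A \in group_ring k 'C_G(R)%G)%MS
           & Brauer_map R b = rel_trace 'Z(R)%G A.
Proof.
move=> Zb b1 block_e fa tr_a; have [phi phi1] := sec_mx_projective fa tr_a.
have nCN : 'N_G(R) \subset 'N('C_G(R)).
  rewrite normsI ?norms_cent ?subsetIr //.
  by rewrite (subset_trans (subsetIl _ _)) ?normG.
have nZN : 'N_G(R) \subset 'N('Z(R)).
  by rewrite (subset_trans (subsetIr _ _)) // char_norms ?center_char.
have [d [rW [iW [theta0 [absW freeW homW tr_th]]]]] :=
  exists_projective_constituent (E := rE) nCN nZN sZC E_Z r_gt0 phi1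
    (fun th => @sec_mx_scalar a th fa tr_a).
have [sc scP] := gring_op_section absW; have [RA opA] := scP theta0.
set A := sc theta0 in RA opA; pose C := 'C_G(R)%G; pose e := Brauer_map R b.
have Re : (e \in group_ring k C)%MS by exact: Brauer_map_mem.
have sZZ : 'Z(R) \subset 'Z(C).
  rewrite subsetI sZC centsC (subset_trans (subsetIr _ _)) //.
  by rewrite centS // center_sub.
pose y := rel_trace 'Z(R)%G A.
have Zy : (y \in 'Z(group_ring k C))%MS by exact: rel_trace_center.
have op_y : gring_op rW y = 1%:M.
  rewrite linear_sum -tr_th; apply: eq_bigr => Y ZY.
  have Ch := repr_rcosets_mem ZY sZC; have Ch' : (repr Y)^-1%g \in C by rewrite groupV.
  by rewrite /= !gring_opM ?envelop_mx_id // !gring_opG // opA.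
have op_e : gring_op rW e = 1%:M.
  apply: (row_free_inj freeW); rewrite mul1mx gring_op_coef // mulmx_suml.
  transitivity (iW *m gring_op rE e); last first.
    by rewrite /e sec_mx_Brauer // b1 sec_mx1 mulmx1.
  rewrite gring_op_coef // mulmx_sumr; apply: eq_bigr => h Ch.
  by rewrite -scalemxAl -scalemxAr homW.
have [[m nil_ye]|[v Zv def_e]] := block_fitting block_e Zy; last first.
  exists (A *m v); first exact: envelop_mxM RA (gring_center_mem Zv).
  by rewrite rel_traceMr.
have opX l : gring_op rW ((y *m e) ^+ l) = 1%:M.
  elim: l => [|l IHl]; first by rewrite expr0 gring_op1.
  have Rye : (y *m e \in group_ring k C)%MS := envelop_mxM (gring_center_mem Zy) Re.
  by rewrite exprSr -[_ * _]/(_ *m (y *m e)) !gring_opM // IHl op_y op_e !mulmx1.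
have /eqP := opX m; rewrite nil_ye linear0 eq_sym -mxrank_eq0 mxrank1.
by have /andP[/lt0n_neq0/negPf -> _] := absW.
Qed.

End SectionAlgebra.

(** Since D centralizes g, right translation by D permutes the terms of the trace at g without
    changing them, and it fixes a coset of the central subgroup Z only if D lies in Z. *)
Lemma rel_trace_support (k : fieldType) (p : nat) (gT : finGroupType)
    (G Z D : {group gT}) (A : 'M[k]_#|G|) g :
    p \in [pchar k] -> Z \subset 'Z(G) -> (A \in group_ring k G)%MS -> g \in G ->
    gring_coef (rel_trace Z A) g != 0 -> p.-group D -> D \subset 'C_G[g] ->
  D \subset Z.
Proof.
move=> charkp sZZ RA Gg nz_g pD sDC; have sZG := subset_trans sZZ (center_sub G).
have sDG : D \subset G := subset_trans sDC (subsetIl _ _).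
apply: contraNT nz_g => nsDZ; rewrite gring_coef_rel_trace //.
pose f x := gring_coef A (x * g * x^-1)%g.
have fZ : left_invariant Z G f.
  move=> z x Zz Gx; rewrite /f; congr (gring_coef A _).
  have /centerP[_ cz] := subsetP sZZ z Zz.
  by rewrite invMg !mulgA -(mulgA z) -(mulgA z) cz ?mulgK ?groupM ?groupV.
have nSD : [acts D, on rcosets Z G | 'Rs].
  exact: subset_trans sDG (actsRs_rcosets Z G).
rewrite /coset_sum (pgroup_sum_fix charkp pD nSD) => [|X d].
  rewrite big_pred0 // => X; apply/negP=> /setIP[/rcosetsP[x Gx ->]].
  rewrite sub_afixRs_norms (normP _) ?(negPf nsDZ) // (subsetP _ x Gx) //.
  by rewrite cents_norm // centsC (subset_trans sZZ) ?subsetIr.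
case/rcosetsP=> x Gx -> Dd; have Gd := subsetP sDG d Dd.
rewrite /= rcosetE -rcosetM -!/(f _) !(left_invariant_repr fZ) ?groupM //.
have /setIP[_ /cent1P cdg] := subsetP sDC d Dd.
by rewrite /f invMg !mulgA -(mulgA x) cdg mulgA mulgK.
Qed.

Section VertexSupport.

Variables (k : closedFieldType) (p : nat) (charkp : p \in [pchar k]).
Variables (gT : finGroupType) (G R : {group gT}).
Variables (n : nat) (rS : mx_representation k G n).
Hypotheses (irrS : mx_irreducible rS) (pR : p.-group R) (vertexR : is_vertex rS R).

Local Notation fixedR := (mx_fixed rS R).
Local Notation idealR := (vertex_ideal R rS).

Let sRG : R \subset G. Proof. by case: vertexR. Qed.

(** Commuting unipotent operators on a nonzero quotient have a common nonzero fixed vector: for each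
    z in turn, a is multiplied by the last power of [rS z] - 1 that keeps it outside the ideal. *)
Lemma center_fixed_nontrivial (K : 'M[k]_(n * n)) :
    (forall v, (v <= K)%MS <-> idealR (vec_mx v)) -> ~ idealR 1%:M ->
  exists2 a, center_fixed R rS a & ~ idealR a.
Proof.
move=> KP nid1.
have Kb a : reflect (idealR a) (mxvec a <= K)%MS.
  by apply: (iffP idP) => [/KP | Ka]; [rewrite mxvecK | apply/KP; rewrite mxvecK].
suffices [a [fa nKa aZ]] : exists a, [/\ fixedR a, ~ idealR a &
    forall z, z \in enum 'Z(R) -> idealR (a *m rS z - a)].
  by exists a => //; split=> // z Zz; apply: aZ; rewrite mem_enum.
have: {subset enum 'Z(R) <= 'Z(R)} by move=> z; rewrite mem_enum.
elim: (enum 'Z(R)) => [|z s IHs] Zs.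
  by exists 1%:M; split=> //; apply: (fixedR1 vertexR).
have [|a [fa nKa aZ]] := IHs; first by move=> w sw; apply: Zs; rewrite inE sw orbT.
have sZC : 'Z(R) \subset 'C_G(R) by exact: setSI.
have fZ w : w \in 'Z(R) -> fixedR (rS w).
  by move=> Zw; apply: (fixedR_repr vertexR); apply: (subsetP sZC).
have Zz : z \in 'Z(R) by apply: Zs; rewrite mem_head.
pose del := rS z - 1%:M.
have fdel : fixedR del.
  rewrite /del addrC -scaleN1r; apply: fixedR_lin; last exact: fZ.
  exact: (fixedR1 vertexR).
have fdelX j : fixedR (del ^+ j).
  elim: j => [|j IHj]; first exact: (fixedR1 vertexR).
  by rewrite exprS; apply: (fixedR_mul vertexR).
have [m oR] := p_natP pR.
have rX j : rS z ^+ j = rS (z ^+ j)%g.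
  have Gz : z \in G by apply: (subsetP (subset_trans sZC (subsetIl _ _))).
  elim: j => [|j IHj]; first by rewrite expr0 expg0 repr_mx1.
  by rewrite exprS expgS IHj repr_mxM ?groupX.
have del0 : del ^+ (p ^ m) = 0.
  apply: (unipotent_sub1_nilpotent charkp).
  by rewrite rX -oR expg_cardG ?repr_mx1 //; case/setIP: Zz.
have exj : exists j, (mxvec (a *m del ^+ j) <= K)%MS.
  by exists (p ^ m)%N; rewrite del0 mulmx0 linear0 sub0mx.
case: (ex_minnP exj) => -[|j] Kj minj.
  by case: nKa; apply/Kb; move: Kj; rewrite expr0 mulmx1.
have faj : fixedR (a *m del ^+ j) by apply: (fixedR_mul vertexR).
exists (a *m del ^+ j); split=> //.
  by move/Kb/minj; rewrite ltnn.
move=> w; rewrite inE => /predU1P[->|sw].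
  have -> : a *m del ^+ j *m rS z - a *m del ^+ j = a *m del ^+ j.+1.
    by rewrite exprSr -[del ^+ j * del]/(_ *m del) {4}/del !mulmxBr mulmx1 mulmxA.
  exact/Kb.
have Zw : w \in 'Z(R) by apply: Zs; rewrite inE sw orbT.
have cw : del *m rS w = rS w *m del.
  rewrite /del mulmxBl mulmxBr mul1mx mulmx1; congr (_ - _).
  have sZG := subset_trans sZC (subsetIl _ _).
  rewrite -!repr_mxM ?(subsetP sZG) //; congr (repr_mx rS _).
  by have /centerP[Rz cz] := Zz; apply: cz; case/setIP: Zw.
have cwX l : del ^+ l *m rS w = rS w *m del ^+ l.
  elim: l => [|l IHl]; first by rewrite mul1mx mulmx1.
  by rewrite exprS -[del * _]/(del *m _) -mulmxA IHl !mulmxA cw.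
rewrite -mulmxA cwX mulmxA -mulmxBl; apply: (vertex_idealMr vertexR) => //.
exact: aZ.
Qed.

(* After Knoerr: Br_R(b) has defect group Z(R), read off from its support.    *)
Lemma vertex_support (b : 'M[k]_#|G|) x (D : {group gT}) :
    (b \in 'Z(group_ring k G))%MS -> gring_op rS b = 1%:M ->
    is_block (Brauer_map R b) -> x \in 'C_G(R) -> gring_coef b x != 0 ->
    p.-group D -> D \subset 'C_G(R) -> D \subset 'C[x] ->
  D \subset R.
Proof.
move=> Zb b1 block_e Cx nz_x pD sDC cDx.
have [_ projR _] := vertexR; have [a fa tr_a] := Higman_trace sRG projR.
have nid1 : ~ idealR 1%:M.
  case=> _ /(_ 1%:M a (fixedR1 vertexR) fa); rewrite !mul1mx tr_a.
  have /mx_irrP[n_gt0 _] := irrS.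
  by move/eqP; rewrite -mxrank_eq0 mxrank1 gtn_eqF.
apply: (subspace_mx (P := fun v => idealR (vec_mx v))) => [|c u v|[K KP]].
- by rewrite linear0; apply: vertex_ideal0.
- by rewrite linearP; apply: vertex_ideal_lin.
apply: (subspace_mx (P := fun v => center_fixed R rS (vec_mx v))) => [|c u v|[X XP]].
- rewrite linear0; split=> [|z _]; first exact: fixedR0.
  by rewrite mul0mx subrr; apply: vertex_ideal0.
- rewrite linearP; set u' := vec_mx u; set v' := vec_mx v => -[fu cu] [fv cv].
  split=> [|z Zz]; first exact: fixedR_lin.
  rewrite mulmxDl -scalemxAl opprD addrACA -scalerBr.
  by apply: vertex_ideal_lin; [apply: cu | apply: cv].
have sKX : (K <= X)%MS.
  apply/row_subP=> j; apply/XP; have /KP Kj := row_sub j K.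
  case: (Kj) => fj _; split=> // z Zz; rewrite addrC -scaleN1r.
  apply: vertex_ideal_lin => //; apply: (vertex_idealMr vertexR) => //.
  by apply: (fixedR_repr vertexR); apply: (subsetP _ z Zz); apply: setSI.
have nsXK : ~~ (X <= K)%MS.
  have [a1 ca1 nid_a1] := center_fixed_nontrivial KP nid1.
  apply/negP=> sXK; case: nid_a1; rewrite -[a1]mxvecK; apply/KP.
  by apply: submx_trans sXK; apply/XP; rewrite mxvecK.
have [r [i [pr [r_gt0 i_pr sub_iX K_pr X_pr]]]] := section_mx sKX nsXK.
have [A RA def_e] := block_rel_trace_center irrS vertexR KP XP r_gt0 i_pr sub_iX
  K_pr X_pr Zb b1 block_e fa tr_a.
apply: (subset_trans _ (center_sub R)).
apply: (rel_trace_support charkp _ RA Cx) => //.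
- rewrite subsetI (setSI _ sRG) centsC (subset_trans (subsetIr _ _)) //.
  by rewrite centS // center_sub.
- by rewrite -def_e Brauer_map_coef.
by rewrite subsetI sDC.
Qed.

End VertexSupport.

(** * Class sums and blocks *)

Section Blocks.

Variables (k : fieldType) (p : nat) (charkp : p \in [pchar k]).
Variables (gT : finGroupType) (G : {group gT}).
Local Notation R_G := (group_ring k G).
Local Notation aG := (regular_repr k G).
Implicit Types (b : 'M[k]_#|G|) (C : {set gT}).

(** The index of a Sylow p-subgroup of P is invertible in k; dividing by it makes b a trace from
    that subgroup, which equals P by minimality. *)
Lemma is_block_defect_pgroup b (P : {group gT}) :
  is_block_defect_group b P -> p.-group P.
Proof.
case=> sPG [a [Ra fa] def_b] minP; have [P0 sylP0] := Sylow_exists p P.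
have [sP0P pP0 p'idx] := and3P sylP0.
suffices /(minP P0 sP0P) <- : in_rel_trace P0 b by [].
have nz_idx : (#|P : P0|%:R : k) != 0.
  by rewrite -(dvdn_pcharf charkp) -p'natE ?(pcharf_prime charkp).
have fixP : mx_fixed aG P a by [].
pose a0 := (#|P : P0|%:R)^-1 *: a.
have fix0 : mx_fixed aG P0 a0.
  move=> x P0x; rewrite /mx_conj -scalemxAr -scalemxAl; congr (_ *: _).
  exact: fa (subsetP sP0P x P0x).
exists a0; first by split; rewrite ?linearZ ?scalemx_sub.
rewrite def_b -[RHS]/(mx_trace aG P0 G a0) (mx_trace_trans sP0P sPG (subxx G) fix0).
rewrite (_ : mx_trace aG P0 P a0 = a) //.
transitivity (\sum_(X in rcosets P0 P) a0); last first.
  by rewrite sumr_const -[#|rcosets P0 P|]/(#|P : P0|) /a0 -scaler_nat scalerA mulfV ?scale1r.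
apply: eq_bigr => X PX; have Px := repr_rcosets_mem PX sP0P.
by rewrite /mx_conj -scalemxAr -scalemxAl -/(mx_conj aG a (repr X)) fixP.
Qed.

Lemma blocks_orthogonal b b' : is_block b -> is_block b' -> b <> b' -> b *m b' = 0.
Proof.
have half b1 b2 : is_block b1 -> is_block b2 -> b1 *m b2 = 0 \/ b1 *m b2 = b1.
  case=> [[Z1 id1] _ prim] [[Z2 id2] _ _].
  have c12 : b1 *m b2 = b2 *m b1 by apply: gring_centerC; rewrite ?gring_center_mem.
  have Z12 : (b1 *m b2 \in 'Z(R_G))%MS by exact: gring_centerM.
  have id12 : b1 *m b2 *m (b1 *m b2) = b1 *m b2.
    by rewrite {2}c12 mulmxA -(mulmxA b1) id2 -mulmxA -c12 mulmxA id1.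
  have b1b12 : b1 *m (b1 *m b2) = b1 *m b2 by rewrite mulmxA id1.
  have b12b1 : b1 *m b2 *m b1 = b1 *m b2 by rewrite -mulmxA -c12 b1b12.
  have [||||->|/eqP] := prim (b1 *m b2) (b1 - b1 *m b2); last 1 first.
  - by rewrite subr_eq0 => /eqP <-; right.
  - by split.
  - split; first by rewrite linearB addmx_sub // eqmx_opp.
    by rewrite mulmxBl !mulmxBr id1 b1b12 b12b1 id12 subrr subr0.
  - by rewrite mulmxBr b12b1 id12 subrr.
  - by rewrite addrC subrK.
  by left.
move=> Bb Bb' neb; have [//|eqb] := half b b' Bb Bb'.
have [Z1 _] : is_central_idempotent b by case: Bb.
have [Z2 _] : is_central_idempotent b' by case: Bb'.
have c12 : b *m b' = b' *m b by apply: gring_centerC; rewrite ?gring_center_mem.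
have [eq0|eqb'] := half b' b Bb' Bb; first by rewrite c12.
by case: neb; rewrite -eqb c12.
Qed.

Lemma gset_mx_mem C : C \subset G -> (gset_mx k G C \in R_G)%MS.
Proof.
move=> sCG; rewrite linear_sum summx_sub // => x Cx.
by apply: envelop_mx_id; apply: (subsetP sCG).
Qed.

Lemma gring_coef_gset C x :
  C \subset G -> x \in G -> gring_coef (gset_mx k G C) x = (x \in C)%:R.
Proof.
move=> sCG Gx; rewrite gring_coef_sum.
have [Cx|nCx] := boolP (x \in C).
  rewrite (bigD1 x) //= big1 => [|y /andP[Cy ne]].
    by rewrite gring_coef_repr // eqxx addr0.
  by have Gy := subsetP sCG y Cy; rewrite gring_coef_repr // (negPf ne).
rewrite big1 // => y Cy; have Gy := subsetP sCG y Cy; rewrite gring_coef_repr //.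
by case: eqP Cy => // ->; rewrite (negPf nCx).
Qed.

Lemma classes_sub C : C \in classes G -> C \subset G.
Proof. by case/imsetP=> x Gx ->; apply: class_subG. Qed.

Lemma gset_mx_center C : C \in classes G -> (gset_mx k G C \in 'Z(R_G))%MS.
Proof.
move=> clC; have sCG := classes_sub clC; apply/gring_center_coefP; split=> [|x y Gx Gy].
  exact: gset_mx_mem.
rewrite !gring_coef_gset ?groupJ //; congr (nat_of_bool _)%:R.
by have /imsetP[z Gz ->] := clC; rewrite class_sym classGidl // class_sym.
Qed.

Lemma gset_mx_preg C : C \in preg_classes p G -> preg_supported p (gset_mx k G C).
Proof.
rewrite inE => /andP[clC /forall_inP pregC] x Gx p_sing.
rewrite gring_coef_gset ?classes_sub //; case: (boolP (x \in C)) => // Cx.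
by rewrite (pregC x Cx) in p_sing.
Qed.

(** Modulo p only factorizations of g inside C_G(D) contribute, so one of them must involve an
    element of C. *)
Lemma class_block_support b C g (D : {group gT}) :
    (b \in 'Z(R_G))%MS -> C \in classes G -> p.-group D -> D \subset G ->
    g \in 'C_G(D) -> gring_coef (gset_mx k G C *m b) g != 0 ->
  exists2 y, y \in C & D \subset 'C_G[y].
Proof.
move=> Zb clC pD sDG Cg; have Zc := gset_mx_center clC.
rewrite (gring_centerC Zc) ?gring_center_mem // (gring_coefM_fix charkp pD) // => nz.
have [y /andP[/setIP[Gy cDy] Cy]|noy] := pickP [pred y in 'C_G(D) | y \in C].
  by exists y; rewrite // subsetI sDG sub_cent1.
case/eqP: nz; rewrite big1 // => y CDy; have /setIP[Gy _] := CDy.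
rewrite gring_coef_gset ?classes_sub //; have := noy y; rewrite inE /= CDy => /= ->.
by rewrite mulr0.
Qed.

Lemma card_cent_class C x y :
  C \in classes G -> x \in C -> y \in C -> #|'C_G[x]| = #|'C_G[y]|.
Proof.
move=> /imsetP[z Gz ->] /imsetP[s Gs ->] /imsetP[t Gt ->].
have cardJ u : u \in G -> #|'C_G[z ^ u]| = #|'C_G[z]|.
  by move=> Gu; rewrite cent1J -{1}(conjGid Gu) -conjIg cardJg.
by rewrite !cardJ.
Qed.

Lemma class_block_support_card b C x g :
    (b \in 'Z(R_G))%MS -> C \in classes G -> x \in C -> g \in G ->
    gring_coef (gset_mx k G C *m b) g != 0 ->
  (#|'C_G[g]|`_p <= #|'C_G[x]|`_p)%N.
Proof.
move=> Zb clC Cx Gg nz; have [D sylD] := Sylow_exists p 'C_G[g].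
have [sDC pD _] := and3P sylD; have sDG := subset_trans sDC (subsetIl _ _).
have Cg : g \in 'C_G(D).
  rewrite inE Gg; apply/centP=> d Dd; have /setIP[_ /cent1P] := subsetP sDC d Dd.
  by move=> cdg; apply/commute_sym.
have [y Cy sDy] := class_block_support Zb clC pD sDG Cg nz.
rewrite -(card_Hall sylD) (card_cent_class clC Cx Cy) dvdn_leq ?part_gt0 //.
by rewrite -(part_pnat_id pD) partn_dvd ?cardG_gt0 // cardSg.
Qed.

End Blocks.

(** Once c b vanishes on C_G(Q), it vanishes on all conjugates of C_G(Q). A defect group of an
    element g of the support lies in a defect group of C; if its order is at least |Q|, it is
    conjugate to Q, which puts a conjugate of g in C_G(Q). *)
Lemma class_block_small_support (k : closedFieldType) (p : nat)
    (gT : finGroupType) (G P Q R : {group gT}) (b : 'M[k]_#|G|) (n : nat)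
    (rS : mx_representation k G n) (C : {set gT}) (x g : gT) :
    p \in [pchar k] -> is_block b -> principal_type p b ->
    is_block_defect_group b P -> is_simple_block_module b rS -> is_vertex rS R ->
    R \subset Q -> Q \proper P -> C \in preg_classes p G -> x \in C ->
    p.-Sylow('C_G[x]) Q -> g \in G ->
    gring_coef (gset_mx k G C *m b) g != 0 ->
  (#|'C_G[g]|`_p < #|Q|)%N.
Proof.
move=> charkp Bb ptypeb defP [irrS b1] vertR sRQ ltQP pregC Cx sylQ Gg nz_g.
have p_pr := pcharf_prime charkp.
have [[Zb _] _ _] := Bb; have sPG : P \subset G by case: defP.
have pP := is_block_defect_pgroup charkp defP.
have sQP := proper_sub ltQP; have sQG := subset_trans sQP sPG.
have sRP := subset_trans sRQ sQP; have pQ := pgroupS sQP pP; have pR := pgroupS sRP pP.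
have clC : C \in classes G by case/setIdP: pregC.
have oQ : (#|'C_G[x]|`_p = #|Q|)%N by rewrite (card_Hall sylQ).
set c := gset_mx k G C in nz_g *; have Zc : (c \in 'Z(group_ring k G))%MS by exact: gset_mx_center.
have Zcb : (c *m b \in 'Z(group_ring k G))%MS by exact: gring_centerM.
have [_ clcb] := (gring_center_coefP _).1 Zcb.
pose H := 'C_G(Q)%G; pose e := Brauer_map Q b.
have sHCR : H \subset 'C_G(R) by rewrite setIS ?centS.
have Be : is_block e by exact: ptypeb defP sQP pQ.
have sZZ : 'Z(Q) \subset 'Z(H).
  rewrite subsetI (setSI _ sQG) centsC (subset_trans (subsetIr _ _)) //.
  by rewrite centS // center_sub.
(* Such a D lies in C_G(R) because R is in Q, so [vertex_support] places it in R, hence in Q; being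
   also in C_G(Q), it lies in Z(Q). *)
have supp_e y (D : {group gT}) : y \in H -> gring_coef e y != 0 ->
    p.-group D -> D \subset 'C_H[y] -> D \subset 'Z(Q).
  move=> Hy; rewrite Brauer_map_coef // => nz_y pD /subsetIP[sDH sDy].
  have BR : is_block (Brauer_map R b) by exact: ptypeb defP sRP pR.
  rewrite subsetI (subset_trans sDH (subsetIr _ _)) andbT; apply: subset_trans sRQ.
  apply: (vertex_support charkp irrS pR vertR Zb b1 BR _ nz_y pD _ sDy).
    exact: (subsetP sHCR).
  exact: subset_trans sDH sHCR.
have ZcH : (Brauer_map Q c \in 'Z(group_ring k H))%MS by exact: Brauer_map_center.
have pregcH : preg_supported p (Brauer_map Q c).
  move=> y Hy p_sing; rewrite Brauer_map_coef //.
  by apply: (gset_mx_preg k pregC) p_sing; case/setIP: Hy.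
have pZ : p.-group 'Z(Q) := pgroupS (center_sub Q) pQ.
have [w ce] := central_defect_preg_scalar charkp sZZ pZ Be supp_e ZcH pregcH.
have cbE y : y \in H -> gring_coef (c *m b) y = w * gring_coef b y.
  move=> Hy; rewrite -(Brauer_map_coef (Q := Q)) // (Brauer_mapM charkp pQ) //.
  by rewrite ce gring_coefZ Brauer_map_coef.
have BP : is_block (Brauer_map P b) by exact: ptypeb defP (subxx P) pP.
have [h0 Ch0 nz_h0] : exists2 h, h \in 'C_G(P) & gring_coef b h != 0.
  have [h /andP[Ch nz]|no] := pickP [pred h in 'C_G(P) | gring_coef b h != 0].
    by exists h.
  have [_ nzP _] := BP; case: nzP; apply: big1 => h Ch.
  have := no h; rewrite inE /= Ch /= => /negbFE/eqP ->; exact: scale0r.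
have Hh0 : h0 \in H by apply: (subsetP _ h0 Ch0); rewrite setIS ?centS.
have w0 : w = 0.
  apply/eqP; apply: contraLR isT => nzw.
  have nz0 : gring_coef (c *m b) h0 != 0 by rewrite cbE // mulf_neq0.
  have [y Cy sPy] := class_block_support charkp Zb clC pP sPG Ch0 nz0.
  have: (#|P| <= #|Q|)%N.
    rewrite -oQ (card_cent_class clC Cx Cy) dvdn_leq ?part_gt0 //.
    by rewrite -(part_pnat_id pP) partn_dvd ?cardG_gt0 // cardSg.
  by rewrite leqNgt (proper_card ltQP).
have cb0 y : y \in H -> gring_coef (c *m b) y = 0 by move/cbE->; rewrite w0 mul0r.
rewrite ltnNge; apply: contra nz_g => leQ; apply: contraT => nz_g.
have [D sylD] := Sylow_exists p 'C_G[g].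
have [sDC pD _] := and3P sylD; have sDG := subset_trans sDC (subsetIl _ _).
have Cg : g \in 'C_G(D).
  rewrite inE Gg; apply/centP=> d Dd; have /setIP[_ /cent1P] := subsetP sDC d Dd.
  by move=> cdg; apply/commute_sym.
have [y Cy sDy] := class_block_support charkp Zb clC pD sDG Cg nz_g.
have [t Gt def_y] : exists2 t, t \in G & y = (x ^ t)%g.
  have /imsetP[z Gz defC] := clC; move: Cx Cy; rewrite defC => Cx.
  by rewrite -(class_eqP Cx) => /imsetP.
have sylQt : p.-Sylow('C_G[y]) (Q :^ t)%G.
  rewrite /= def_y cent1J -{1}(conjGid Gt) -conjIg.
  by rewrite pHallJ2.
have [s Cs sDs] := Sylow_subJ sylQt sDy pD.
have Gs : s \in G by case/setIP: Cs.
have defD : D :=: (Q :^ t) :^ s.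
  apply/eqP; rewrite eqEcard sDs !cardJg.
  by rewrite (card_Hall sylD).
have Gts : (t * s)%g \in G by rewrite groupM.
have Hg : (g ^ (t * s)^-1)%g \in H.
  rewrite inE groupJ ?groupV //=; apply/centP=> q Qq.
  have /setIP[_ /centP cgD] := Cg.
  apply: (conjg_inj (t * s)%g); rewrite (conjMg _ q) (conjMg q) conjgKV; apply: cgD.
  by rewrite defD -conjsgM memJ_conjg.
by rewrite -(clcb g (t * s)^-1%g) ?groupV // cb0 ?eqxx in nz_g.
Qed.

(** * Independence and counting of p-regular classes multiplied by their blocks *)

Section ClassFamilies.

Variables (k : fieldType) (p : nat) (gT : finGroupType) (G : {group gT}).
Variable clp : 'M[k]_#|G| -> {set {set gT}}.
Hypothesis clpP : is_block_class_decomposition p clp.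
Local Notation R_G := (group_ring k G).
Implicit Types (C : {set gT}) (W : {set {set gT}}).

Definition block_of_class C (b : 'M[k]_#|G|) := is_block b /\ C \in clp b.

Lemma block_of_class_inj C b b' :
  block_of_class C b -> block_of_class C b' -> b = b'.
Proof.
case=> Bb Cb [Bb' Cb']; have [_ _ disj _] := clpP.
have [//|/eqP neb] := eqVneq b b'.
by have /pred0P/(_ C) := disj b b' Bb Bb' neb; rewrite /= Cb Cb'.
Qed.

(** Multiplying a relation by one block kills the terms of the other blocks and leaves a relation
    inside the basis that the decomposition provides for that block. *)
Lemma class_block_free W (beta : {set gT} -> 'M[k]_#|G|) :
    (forall C, C \in W -> block_of_class C (beta C)) ->
  row_free (\matrix_(i < #|W|) mxvec (gset_mx k G (enum_val i) *m beta (enum_val i))).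
Proof.
move=> betaP; rewrite -kermx_eq0; apply/rowV0P=> u /sub_kermxP.
rewrite mulmx_sum_row => sum0; apply/rowP=> i; rewrite mxE.
pose C0 := enum_val i; have WC0 : C0 \in W by exact: enum_valP.
pose c C := u 0 (enum_rank_in WC0 C).
have ci : u 0 i = c C0 by rewrite /c enum_valK_in.
have {}sum0 : \sum_(C in W) c C *: (gset_mx k G C *m beta C) = 0.
  apply: (can_inj mxvecK); rewrite linear0 -[RHS]sum0 linear_sum big_enum_val.
  by apply: eq_bigr => j _; rewrite linearZ /= rowK /c enum_valK_in.
pose b := beta C0; have [Bb C0b] := betaP C0 WC0.
have [_ _ _ /(_ b Bb)[freeb _]] := clpP.
(* Classes of [clp b] outside W receive the coefficient 0, which extends the relation to the whole
   basis. *)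
pose w : 'rV_#|clp b| := \row_j (if enum_val j \in W then c (enum_val j) else 0).
have w0 : w *m class_family b (clp b) = 0.
  rewrite mulmx_sum_row; apply: (can_inj vec_mxK); rewrite linear0.
  rewrite -[RHS](mul0mx _ b) -[X in _ = X *m b]sum0 mulmx_suml linear_sum.
  rewrite (eq_bigr (fun j => if enum_val j \in W then
      c (enum_val j) *: (gset_mx k G (enum_val j) *m b) else 0)); last first.
    move=> j _; rewrite linearZ /= rowK mxvecK mxE.
    by case: ifP => // _; rewrite scale0r.
  rewrite -(big_enum_val (fun C => if C \in W then
      c C *: (gset_mx k G C *m b) else 0)).
  rewrite -big_mkcondr /= [RHS](bigID (mem (clp b))) /= [X in _ = _ + X]big1 ?addr0.
    apply: eq_big => [C|C /andP[bC WC]]; first exact: andbC.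
    have -> : beta C = b by apply: block_of_class_inj (betaP C WC) _.
    by rewrite -scalemxAl -mulmxA; case: Bb => -[_ ->].
  move=> C /andP[WC nbC]; have [Bc Cc] := betaP C WC.
  have bb0 : beta C *m b = 0.
    by apply: blocks_orthogonal => // eqb; case/negP: nbC; rewrite -eqb.
  by rewrite -scalemxAl -mulmxA bb0 mulmx0 scaler0.
have /rowP/(_ (enum_rank_in C0b C0)) : w = 0.
  by apply: (row_free_inj freeb); rewrite w0 mul0mx.
by rewrite !mxE enum_rankK_in // WC0 ci.
Qed.

Lemma center_sub_class_sums W (z : 'M[k]_#|G|) :
    W \subset classes G -> (z \in 'Z(R_G))%MS ->
    (forall g, g \in G -> gring_coef z g != 0 -> g ^: G \in W) ->
  (z \in \matrix_(i < #|W|) mxvec (gset_mx k G (enum_val i)))%MS.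
Proof.
move=> sW /gring_center_coefP[Rz clz] suppz.
have -> : z = \sum_(C in W) gring_coef z (repr C) *: gset_mx k G C.
  apply: gring_coef_inj => //.
    rewrite linear_sum summx_sub // => C WC; rewrite linearZ scalemx_sub //.
    exact: gset_mx_mem (classes_sub (subsetP sW C WC)).
  move=> g Gg; rewrite gring_coef_sum.
  have coefC C : C \in W -> gring_coef (gring_coef z (repr C) *: gset_mx k G C) g
      = if C == g ^: G then gring_coef z g else 0.
    move=> WC; have clC := subsetP sW C WC; have sCG := classes_sub clC.
    rewrite gring_coefZ gring_coef_gset //; have [x Gx defC] := imsetP clC.
    have -> : (g \in C) = (C == g ^: G).
      by rewrite defC; apply/class_eqP/eqP => ->.
    case: eqP => [->|_]; last by rewrite mulr0.
    by have [y Gy ->] := repr_class G g; rewrite clz // mulr1.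
  rewrite (eq_bigr _ coefC) -big_mkcondr /=.
  have [Wg|nWg] := boolP (g ^: G \in W).
    rewrite (big_pred1 (g ^: G)) // => C /=.
    by case: eqP => [->|_]; rewrite ?Wg ?andbF.
  rewrite big_pred0 => [|C]; last by case: eqP => [->|_]; rewrite ?(negPf nWg) ?andbF.
  by apply/eqP; apply: contraR nWg; apply: suppz.
rewrite linear_sum summx_sub // => C WC; rewrite linearZ scalemx_sub //.
by rewrite (eq_row_sub (enum_rank_in WC C)) // rowK enum_rankK_in.
Qed.

(* Otherwise the products of C0 and of the #|F| classes of smaller defect     *)
(* with their blocks are #|F|.+1 independent elements of the span of F.       *)
Lemma class_block_defect_attained (charkp : p \in [pchar k]) b C0 x :
    is_block b -> C0 \in clp b -> x \in C0 ->
  exists2 g, g \in G & gring_coef (gset_mx k G C0 *m b) g != 0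
                       /\ (#|'C_G[x]|`_p <= #|'C_G[g]|`_p)%N.
Proof.
move=> Bb bC0 C0x; have [sub_clp clp_cover _ _] := clpP.
have [g /and3P[Gg nz le]|small] := pickP [pred g in G |
    (gring_coef (gset_mx k G C0 *m b) g != 0) && (#|'C_G[x]|`_p <= #|'C_G[g]|`_p)%N].
  by exists g.
have pregC0 : C0 \in preg_classes p G by exact: subsetP (sub_clp b Bb) C0 bC0.
have clC0 : C0 \in classes G by case/setIdP: pregC0.
have reprC C : C \in classes G -> repr C \in C.
  by case/imsetP=> z _ ->; have [y Gy ->] := repr_class G z; rewrite memJ_class.
pose F := [set C in preg_classes p G | #|'C_G[repr C]|`_p < #|'C_G[x]|`_p]%N.
have sF : F \subset classes G by apply/subsetP=> C /setIdP[/setIdP[]].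
have nFC0 : C0 \notin F.
  by rewrite inE pregC0 (card_cent_class clC0 (reprC C0 clC0) C0x) ltnn.
have /fin_all_exists[beta betaP] C : exists b' : 'M[k]_#|G|,
    C \in preg_classes p G -> block_of_class C b'.
  (* The value 0 stands in for sets that are not p-regular classes. *)
  have [/clp_cover[b' Bb' b'C]|_] := boolP (C \in preg_classes p G); last by exists 0.
  by exists b'.
have beta0 : beta C0 = b by apply: block_of_class_inj (betaP C0 pregC0) _.
pose W := C0 |: F.
have pregW C : C \in W -> C \in preg_classes p G.
  by case/setU1P=> [->|/setIdP[]].
have freeW := class_block_free (fun C WC => betaP C (pregW C WC)).
have sWF : (\matrix_(i < #|W|) mxvec (gset_mx k G (enum_val i) *m beta (enum_val i))
    <= \matrix_(i < #|F|) mxvec (gset_mx k G (enum_val i)))%MS.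
  apply/row_subP=> i; rewrite rowK; move: (enum_val i) (enum_valP i) => C WC.
  have [Bb' _] := betaP C (pregW C WC); have [[Zb' _] _ _] := Bb'.
  have pregC := pregW C WC; have clC : C \in classes G by case/setIdP: pregC.
  have Zc := gset_mx_center k clC.
  (* Osima's theorem keeps the support p-regular. Its defects are below that of C0 by the assumption
     [small] when the class is C0, and by the defect of the class itself otherwise. *)
  apply: center_sub_class_sums => // [|g Gg nz_g]; first exact: gring_centerM.
  have clg : g ^: G \in classes G by exact: mem_classes.
  rewrite inE (card_cent_class clg (reprC _ clg) (class_refl G g)); apply/andP; split.
    rewrite inE clg; apply/forall_inP=> _ /imsetP[y Gy ->]; rewrite p_eltJ.
    apply: contraR nz_g => g_sing; apply/eqP.
    by apply: (preg_supportedM_idem charkp Zc (gset_mx_preg k pregC)) g_sing; case: Bb'.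
  have [eqC|] := setU1P WC.
    rewrite eqC beta0 in nz_g.
    by have := small g; rewrite inE /= Gg nz_g /= leqNgt => /negbFE.
  case/setIdP=> _; apply: leq_ltn_trans.
  exact: (class_block_support_card charkp Zb' clC (reprC C clC) Gg nz_g).
have := leq_trans (mxrankS sWF) (rank_leq_row _).
by rewrite (eqP freeW) cardsU1 nFC0 ltnn.
Qed.

End ClassFamilies.

End BlocksOfPrincipalType.
Import BlocksOfPrincipalType.

Theorem theorem1p2 (k : closedFieldType) (p : nat)
  (charkp : p \in [pchar k]%R)
  (gT : finGroupType) (G : {group gT})
  (b : 'M[k]_#|G|) (b_block : is_block b) (b_ptype : principal_type p b)
  (P : {group gT}) (P_defect : is_block_defect_group b P)
  (n : nat) (rS : mx_representation k G n)
  (S_simple : is_simple_block_module b rS)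
  (R : {group gT}) (R_vertex : is_vertex rS R)
  (clp : 'M[k]_#|G| -> {set {set gT}})
  (clp_decomp : is_block_class_decomposition p clp)
  (Q : {group gT}) (sRQ : R \subset Q) (ltQP : Q \proper P) :
  lower_defect_mult p G (clp b) Q = 0.
Proof.
apply/eqP; rewrite cards_eq0; apply/set0Pn=> -[C]; rewrite inE.
case/andP=> bC /existsP[D /andP[/exists_inP[y Cy sylD] /imsetP[t Gt defD]]].
have [/(_ b b_block)/subsetP/(_ C bC) pregC _ _ _] := clp_decomp.
(* Since D = Q^t, moving y by t^-1 gives an element of C with defect group Q itself. *)
have Gt' := groupVr Gt; pose x := (y ^ t^-1)%g.
have Cx : x \in C.
  case/setIdP: pregC => /imsetP[z Gz defC] _; rewrite defC in Cy *.
  by rewrite -(class_eqP Cy) memJ_class.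
have sylQ : p.-Sylow('C_G[x])%g Q.
  rewrite (_ : gval Q = D :^ t^-1)%g; last by rewrite defD conjsgK.
  by rewrite /= cent1J -{1}(conjGid Gt') -conjIg pHallJ2.
have [g Gg [nz_g]] := class_block_defect_attained clp_decomp charkp b_block bC Cx.
rewrite -(card_Hall sylQ) leqNgt => /negP[].
exact: (class_block_small_support charkp b_block b_ptype P_defect S_simple
  R_vertex sRQ ltQP pregC Cx sylQ Gg nz_g).
Qed.
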